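(* Let $G$ be a countable, finitely generated, residually amenable group, endowed with a proper length function $l$ and its associated left-invariant metric $d(g,h)=l(g^{-1}h)$. Call a sequence $(G_n)_{n\in\mathbb{N}}$ of normal subgroups of $G$ *admissible* if $G_{n+1}\subset G_n$ for every $n$, $\bigcap_{n\in\mathbb{N}}G_n=\{e_G\}$, and each quotient group $G/G_n$ is amenable. Then the following are equivalent: (a) $G$ admits a proper isometric affine action on some uniformly convex Banach space; (b) there exists an admissible sequence $(G_n)_{n\in\mathbb{N}}$ such that the corresponding box family $\{(G/G_n,d_n):n\in\mathbb{N}\}$ admits a fibred cofinitely-coarse embedding into some uniformly convex Banach space; (c) for every admissible sequence $(G_n)_{n\in\mathbb{N}}$, the corresponding box family $\{(G/G_n,d_n):n\in\mathbb{N}\}$ admits a fibred cofinitely-coarse embedding into some uniformly convex Banach space.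
   Context: **Residually amenable group.** A countable, finitely generated group $G$ is residually amenable if there exists a sequence $(G_n)_{n\in\mathbb{N}}$ of normal subgroups of $G$ with $G_{n+1}\subset G_n$ for every $n$, $\bigcap_{n\in\mathbb{N}} G_n=\{e_G\}$, and each quotient group $G/G_n$ amenable. **Proper length function.** A function $l:G\to[0,\infty)$ with $l(g)=0$ iff $g=e_G$, $l(g^{-1})=l(g)$, $l(gh)\le l(g)+l(h)$, and $\{g\in G: l(g)\le R\}$ finite for every $R\geq 0$. **Box family.** Given such a sequence $(G_n)$, for each $n$ the formula $l_n([g]):=\inf\{l(gh):h\in G_n\}$ defines a length function on $G/G_n$; let $d_n([g],[h])=l_n([g]^{-1}[h])$ be the induced metric. The box family of $G$ corresponding to $(G_n)_{n\in\mathbb{N}}$ is the family $\{(G/G_n,d_n):n\in\mathbb{N}\}$, indexed by $n$ and regarded as a family of pairwise disjoint metric spaces. **Uniform convexity.** Banach spaces are over $\mathbb{R}$. The modulus of convexity of a Banach space $B$ is $\delta_B:[0,2]\to[0,1]$, $$\delta_B(t)=\inf\Big\{1-\Big\|\tfrac{\xi+\xi'}{2}\Big\|_B:\xi,\xi'\in B,\ \|\xi\|_B=\|\xi'\|_B=1,\ \|\xi-\xi'\|_B\ge t\Big\}.$$ $B$ is uniformly convex if $\delta_B(t)>0$ for every $t>0$. **Proper isometric affine action.** An affine isometry of $B$ is a map $\xi\mapsto I(\xi)+b$ with $I:B\to B$ a bijective linear isometry and $b\in B$; these form a group $\mathrm{AffIsom}(B)$ under composition. An isometric affine action of $G$ on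 $B$ is a homomorphism $\alpha:G\to\mathrm{AffIsom}(B)$. It is proper if for every $\xi\in B$ and every bounded $A\subset B$ the set $\{g\in G:\alpha(g)(\xi)\in A\}$ is finite. **Fibred cofinitely-coarse embedding.** A family $\mathscr{X}$ of disjoint metric spaces admits a fibred cofinitely-coarse embedding into a metric space $(Y,d_Y)$ if there exist - a field of metric spaces $(Y_x)_{x\in\bigcup\mathscr{X}}$ with each $Y_x$ isometric to $Y$; - a section $s:\bigcup\mathscr{X}\to\bigsqcup_{x\in\bigcup\mathscr{X}}Y_x$, i.e. $s(x)\in Y_x$ for all $x$; - two non-decreasing functions $\rho_1,\rho_2:[0,\infty)\to(-\infty,\infty)$ with $\lim_{r\to\infty}\rho_i(r)=\infty$ for $i=1,2$; such that for every $r>0$ there is a finite subfamily $K_r\subset\mathscr{X}$ such that, for every $(X,d_X)\in\mathscr{X}\setminus K_r$ and every subset $C\subset X$ of diameter less than $r$, there is a trivialization $t_C:(Y_x)_{x\in C}\to C\times Y$, that is, a family of bijective isometries $t_C(x):Y_x\to Y$ ($x\in C$), satisfying: (i) for all $x,x'\in C$, $\rho_1(d_X(x,x'))\le d_Y\big(t_C(x)(s(x)),t_C(x')(s(x'))\big)\le\rho_2(d_X(x,x'))$; (ii) for any two subsets $C_1,C_2\subset X$ of diameter less than $r$ with $C_1\cap C_2\ne\varnothing$, there is an isometry $t_{C_1C_2}:Y\to Y$ such that $t_{C_1}(x)\circ t_{C_2}(x)^{-1}=t_{C_1C_2}$ for all $x\in C_1\cap C_2$. A Banach space is regarded as a metric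 space via its norm. *)

(* Defs.v *)
From HB Require Import structures.
From mathcomp Require Import all_boot all_order all_algebra.
From mathcomp Require Import all_classical all_reals all_analysis.

Set Implicit Arguments.
Unset Strict Implicit.
Unset Printing Implicit Defensive.

Import Order.TTheory GRing.Theory Num.Theory.
Import numFieldNormedType.Exports.

Local Open Scope classical_set_scope.
Local Open Scope ring_scope.
Local Open Scope quotient_scope.

Section Groups.
Variable G : groupType.

Definition is_subgroup (S : set G) : Prop := group_closed [in S].

Definition finitely_generated : Prop :=
  exists2 S : set G, finite_set S &
    forall H : set G, is_subgroup H -> S `<=` H -> H = setT.

Record normal_subgroup := NormalSubgroup {
  nsg_set :> set G;
  nsg_subgroup : is_subgroup nsg_set;
  nsg_conj : forall x y, nsg_set x -> nsg_set (x ^ y)%g }.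

(* Existence of a left-invariant mean on the space of bounded real functions
   on G; the values of m outside that space are irrelevant. *)
Definition amenable (R : realType) : Prop :=
  exists m : (G -> R) -> R,
  [/\ forall (a : R) (f g : G -> R), bounded_fun f -> bounded_fun g ->
        m (fun x => a * f x + g x) = a * m f + m g,
      forall f : G -> R, bounded_fun f -> (forall x, 0 <= f x) -> 0 <= m f,
      m (fun=> 1) = 1
    & forall (h : G) (f : G -> R), bounded_fun f ->
        m (fun x => f (h^-1 * x)%g) = m f].

End Groups.

Section QuotientGroup.
Variables (G : groupType) (N : normal_subgroup G).
Implicit Types x y z : G.

Lemma nsg1 : nsg_set N 1%g.
Proof. by have [/set_mem] := nsg_subgroup N. Qed.

Lemma nsgV x : nsg_set N x -> nsg_set N x^-1%g.
Proof.
by move=> /mem_set xN; apply/set_mem/(group_closedV (nsg_subgroup N)).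
Qed.

Lemma nsgM x y : nsg_set N x -> nsg_set N y -> nsg_set N (x * y)%g.
Proof.
move=> /mem_set xN /mem_set yN.
by apply/set_mem/(group_closedM (nsg_subgroup N)).
Qed.

Definition coset_rel x y : bool := `[< nsg_set N (x^-1 * y)%g >].

Let coset_rel_refl : reflexive coset_rel.
Proof. by move=> x; apply/asboolP; rewrite mulVg; exact: nsg1. Qed.

Let coset_relW x y : coset_rel x y -> coset_rel y x.
Proof.
by move=> /asboolP/nsgV xy; apply/asboolP; rewrite invgM invgK in xy.
Qed.

Let coset_rel_sym : symmetric coset_rel.
Proof. by move=> x y; apply/idP/idP; exact: coset_relW. Qed.

Let coset_rel_trans : transitive coset_rel.
Proof.
move=> y x z /asboolP xy /asboolP yz; apply/asboolP.
by have := nsgM xy yz; rewrite -mulgA mulVKg.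
Qed.

Canonical coset_rel_equiv :=
  EquivRel coset_rel coset_rel_refl coset_rel_sym coset_rel_trans.

Definition quotient_group : Type := {eq_quot coset_rel}.
HB.instance Definition _ := Choice.on quotient_group.
HB.instance Definition _ := EqQuotient.on quotient_group.

Local Notation Q := quotient_group.
Local Notation cls := (\pi_Q).

Lemma clsP x y : cls x = cls y <-> nsg_set N (x^-1 * y)%g.
Proof.
split=> [/eqP|xy]; first by rewrite eqmodE => /asboolP.
by apply/eqP; rewrite eqmodE; apply/asboolP.
Qed.

Definition quotg_one : Q := cls 1%g.
Definition quotg_inv (p : Q) : Q := cls (repr p)^-1%g.
Definition quotg_mul (p q : Q) : Q := cls (repr p * repr q)%g.

Lemma quotg_mulE x y : quotg_mul (cls x) (cls y) = cls (x * y)%g.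
Proof.
apply/clsP; set x' := repr _; set y' := repr _.
have xx' : nsg_set N (x'^-1 * x)%g by apply/clsP; rewrite reprK.
have yy' : nsg_set N (y'^-1 * y)%g by apply/clsP; rewrite reprK.
have -> : ((x' * y')^-1 * (x * y) = (x'^-1 * x) ^ y' * (y'^-1 * y))%g.
  by rewrite conjgE invgM !mulgA mulgK.
by apply: nsgM => //; exact: nsg_conj.
Qed.

Lemma quotg_invE x : quotg_inv (cls x) = cls x^-1%g.
Proof.
apply/clsP; set x' := repr _.
have xx' : nsg_set N (x'^-1 * x)%g by apply/clsP; rewrite reprK.
have -> : (x'^-1^-1 * x^-1 = ((x'^-1 * x)^-1) ^ (x'^-1))%g.
  by rewrite conjgE invgM !invgK mulgK.
by apply: nsg_conj; exact: nsgV.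
Qed.

Let quotg_mulA : associative quotg_mul.
Proof.
move=> p q r; elim/quotW: p => x; elim/quotW: q => y; elim/quotW: r => z.
by rewrite (quotg_mulE y z) (quotg_mulE x y) !quotg_mulE mulgA.
Qed.

Let quotg_mul1 : left_id quotg_one quotg_mul.
Proof. by move=> p; elim/quotW: p => x; rewrite quotg_mulE mul1g. Qed.

Let quotg_mulr1 : right_id quotg_one quotg_mul.
Proof. by move=> p; elim/quotW: p => x; rewrite quotg_mulE mulg1. Qed.

Let quotg_mulV : left_inverse quotg_one quotg_inv quotg_mul.
Proof. by move=> p; elim/quotW: p => x; rewrite (quotg_invE x) quotg_mulE mulVg. Qed.

Let quotg_mulrV : right_inverse quotg_one quotg_inv quotg_mul.
Proof. by move=> p; elim/quotW: p => x; rewrite (quotg_invE x) quotg_mulE mulgV. Qed.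

HB.instance Definition _ := isGroup.Build Q
  quotg_mulA quotg_mul1 quotg_mulr1 quotg_mulV quotg_mulrV.

Lemma pi_quotgM x y : cls (x * y)%g = (cls x * cls y)%g.
Proof. by rewrite -quotg_mulE. Qed.

Lemma pi_quotgV x : cls x^-1%g = (cls x)^-1%g.
Proof. by rewrite -quotg_invE. Qed.

Lemma pi_quotg1 : cls 1%g = 1%g.
Proof. by []. Qed.

End QuotientGroup.

Section Length.
Variable R : realType.

Record length_function (H : groupType) := LengthFunction {
  len_fun :> H -> R;
  len_ge0 : forall g, 0 <= len_fun g;
  len_eq0 : forall g, len_fun g = 0 <-> g = 1%g;
  lenV : forall g, len_fun g^-1%g = len_fun g;
  lenM : forall g h, len_fun (g * h)%g <= len_fun g + len_fun h }.

Definition proper_length (H : groupType) (l : length_function H) : Prop :=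
  forall r : R, 0 <= r -> finite_set [set g | l g <= r].

Definition length_dist (H : groupType) (l : length_function H) (g h : H) : R :=
  l (g^-1 * h)%g.

Section LengthDist.
Variables (H : groupType) (l : length_function H).

Lemma length_distxx g : length_dist l g g = 0.
Proof. by rewrite /length_dist mulVg; apply/len_eq0. Qed.

Lemma length_dist_eq0 g h : length_dist l g h = 0 -> g = h.
Proof. by move/len_eq0/mulg1_eq; rewrite invgK. Qed.

Lemma length_dist_sym g h : length_dist l g h = length_dist l h g.
Proof. by rewrite /length_dist -lenV invgM invgK. Qed.

Lemma length_dist_triangle h g k :
  length_dist l g k <= length_dist l g h + length_dist l h k.
Proof. by rewrite (le_trans _ (lenM l _ _))// -mulgA mulVKg. Qed.

End LengthDist.

Record proper_length_function (H : groupType) := ProperLengthFunction {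
  plen :> length_function H;
  plen_proper : proper_length plen }.

End Length.

Section CosetLength.
Variables (R : realType) (G : groupType) (l : proper_length_function R G).
Variable N : normal_subgroup G.
Local Notation Q := (quotient_group N).

Definition coset_length (q : Q) : R := inf [set l (repr q * h)%g | h in N].

Let coset_lb (g : G) : has_inf [set l (g * h)%g | h in N].
Proof.
split; first by exists (l (g * 1)%g), 1%g => //; exact: nsg1.
by exists 0 => _ [h _ <-]; exact: len_ge0.
Qed.

Lemma coset_lengthE (g : G) :
  coset_length (\pi_Q g) = inf [set l (g * h)%g | h in N].
Proof.
rewrite /coset_length; set g' := repr _; congr inf.
have gg' : nsg_set N (g'^-1 * g)%g by apply/clsP; rewrite reprK.
apply/seteqP; split=> _ [h hN <-].
- exists (g^-1 * g' * h)%g; last by rewrite !mulgA mulgV mul1g.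
  by apply: nsgM => //; have := nsgV gg'; rewrite invgM invgK.
- exists (g'^-1 * g * h)%g; last by rewrite !mulgA mulgV mul1g.
  exact: nsgM.
Qed.

Lemma coset_length_le (g : G) : coset_length (\pi_Q g) <= l g.
Proof.
rewrite coset_lengthE; apply: ge_inf; first exact: (coset_lb g).2.
by exists 1%g; [exact: nsg1 | rewrite mulg1].
Qed.


(* The infimum is attained, by properness of l. *)
Lemma coset_length_min (q : Q) :
  exists2 g : G, \pi_Q g = q & l g = coset_length q.
Proof.
have seq_min (t : seq G) a :
    exists2 i, i \in a :: t & forall h, h \in a :: t -> l i <= l h.
  elim: t a => [|b t ih] a.
    by exists a; [exact: mem_head | move=> h; rewrite inE => /eqP ->].
  have [i it imin] := ih b; have [ai|ia] := leP (l a) (l i).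
    exists a; [exact: mem_head | move=> h; rewrite inE => /orP[/eqP ->//|ht]].
    exact: le_trans ai (imin _ ht).
  exists i; [by rewrite inE it orbT | move=> h; rewrite inE => /orP[/eqP ->|]].
    exact: ltW.
  exact: imin.
rewrite -[q]reprK; set g0 := repr q.
pose A := [set g : G | \pi_Q g = \pi_Q g0 /\ l g <= l g0].
have finA : finite_set A.
  by apply: sub_finite_set (@plen_proper _ _ l _ (len_ge0 l g0)) => g [].
have Ag0 : A g0 by [].
have [[|a t] tA] := (finite_seqP A).1 finA; first by move: Ag0; rewrite tA.
have [g gt gmin] := seq_min t a.
have [gg0 gle] : A g by rewrite tA.
exists g => //; apply/eqP; rewrite eq_le -gg0 coset_length_le andbT.
rewrite coset_lengthE; apply: lb_le_inf; first exact: (coset_lb g).1.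
move=> _ [h hN <-]; have [ghle|/ltW ghge] := leP (l (g * h)%g) (l g0).
  apply: gmin; suff : A (g * h)%g by rewrite tA.
  split=> //; rewrite -gg0; apply/esym/clsP.
  by rewrite mulKg.
exact: le_trans gle ghge.
Qed.

Let coset_length_ge0 q : 0 <= coset_length q.
Proof. by have [g _ <-] := coset_length_min q; exact: len_ge0. Qed.

Let coset_length_eq0 q : coset_length q = 0 <-> q = 1%g.
Proof.
split=> [|->].
  by have [g <- <-] := coset_length_min q; move/len_eq0 ->.
apply/eqP; rewrite eq_le coset_length_ge0 andbT -pi_quotg1.
by rewrite -[leRHS](iffRL (len_eq0 l 1%g) erefl) coset_length_le.
Qed.

Let coset_length_leV q : coset_length q^-1%g <= coset_length q.
Proof.
have [g <- <-] := coset_length_min q.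
by rewrite -pi_quotgV -(lenV l g) coset_length_le.
Qed.

Let coset_lengthV q : coset_length q^-1%g = coset_length q.
Proof.
apply/eqP; rewrite eq_le coset_length_leV/=.
by rewrite -{1}[q]invgK coset_length_leV.
Qed.

Let coset_lengthM p q :
  coset_length (p * q)%g <= coset_length p + coset_length q.
Proof.
have [g <- <-] := coset_length_min p; have [h <- <-] := coset_length_min q.
by rewrite -pi_quotgM (le_trans (coset_length_le _))// lenM.
Qed.

Definition coset_length_function : length_function R Q :=
  LengthFunction coset_length_ge0 coset_length_eq0 coset_lengthV coset_lengthM.

End CosetLength.

(* The phantom parameter l determines the metric. *)
Definition box_space (R : realType) (G : groupType)
  (l : proper_length_function R G) (N : normal_subgroup G) : Type :=
  quotient_group N.

Section BoxSpace.
Variables (R : realType) (G : groupType) (l : proper_length_function R G).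
Variable N : normal_subgroup G.

HB.instance Definition _ := Choice.on (box_space l N).

Definition box_dist : box_space l N -> box_space l N -> R :=
  length_dist (coset_length_function l N).

HB.instance Definition _ := isMetric.Build R (box_space l N)
  (length_distxx (coset_length_function l N))
  (@length_dist_eq0 _ _ (coset_length_function l N))
  (length_dist_sym (coset_length_function l N))
  (length_dist_triangle (coset_length_function l N)).

Lemma box_mdistE (p q : box_space l N) : mdist p q = box_dist p q.
Proof. by []. Qed.

End BoxSpace.

Section Metric.
Variable R : realType.

(* Bijective isometries, with their inverse. *)
Record metric_isometry (X Y : metricType R) := MetricIsometry {
  iso_fun :> X -> Y;
  iso_inv : Y -> X;
  iso_funK : cancel iso_fun iso_inv;
  iso_invK : cancel iso_inv iso_fun;
  iso_dist : forall x y, mdist (iso_fun x) (iso_fun y) = mdist x y }.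

Definition is_isometry (X Y : metricType R) (f : X -> Y) : Prop :=
  forall x y, mdist (f x) (f y) = mdist x y.

Definition diameter (X : metricType R) (C : set X) : \bar R :=
  ereal_sup [set (mdist x y)%:E | x in C & y in C].

(* The values of rho outside [0, +oo[ are irrelevant. *)
Definition control_function (rho : R -> R) : Prop :=
  (forall u v, 0 <= u -> u <= v -> rho u <= rho v) /\
  rho u @[u --> +oo] --> +oo.

(* The family (X i) is regarded as disjoint: a point is a pair (i, x) with
   x : X i. The values of a trivialization t C outside C are irrelevant, and
   so are those of t at sets C of diameter at least r. *)
Definition fibred_cofinitely_coarse_embedding (I : Type)
    (X : I -> metricType R) (Y : metricType R) : Prop :=
  exists (F : forall i, X i -> metricType R) (s : forall i (x : X i), F i x)
    (rho1 rho2 : R -> R),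
  [/\ forall i x, inhabited (metric_isometry (F i x) Y),
      control_function rho1,
      control_function rho2
    & forall r : R, 0 < r ->
      exists2 K : set I, finite_set K & forall i, ~ K i ->
      exists t : set (X i) -> forall x : X i, metric_isometry (F i x) Y,
        (forall C : set (X i), (diameter C < r%:E)%E ->
          forall x x', C x -> C x' ->
            rho1 (mdist x x') <= mdist (t C x (s i x)) (t C x' (s i x'))
                              <= rho2 (mdist x x')) /\
        (forall C1 C2 : set (X i),
          (diameter C1 < r%:E)%E -> (diameter C2 < r%:E)%E ->
          C1 `&` C2 !=set0 ->
          exists2 t12 : Y -> Y, is_isometry t12 &
            forall x, (C1 `&` C2) x -> t C1 x \o iso_inv (t C2 x) = t12)].

End Metric.

Section Banach.
Variables (R : realType) (B : completeNormedModType R).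

Definition banach_metric : Type := B.
HB.instance Definition _ := PseudoMetric.on banach_metric.

Definition norm_dist (x y : banach_metric) : R := `|(x : B) - (y : B)|.

Let norm_dist_ge0 x y : 0 <= norm_dist x y.
Proof. exact: normr_ge0. Qed.

Let norm_dist_eq0 x y : norm_dist x y = 0 -> x = y.
Proof. by move/normr0_eq0/eqP; rewrite subr_eq0 => /eqP. Qed.

Let ball_norm_dist (x : banach_metric) (d : R) :
  ball x d = [set y | norm_dist x y < d].
Proof. by rewrite -ball_normE. Qed.

HB.instance Definition _ := PseudoMetric_isMetric.Build R banach_metric
  norm_dist_ge0 norm_dist_eq0 ball_norm_dist.

Lemma banach_mdistE (x y : banach_metric) : mdist x y = `|(x : B) - (y : B)|.
Proof. by []. Qed.

(* If B is the zero space, the infimum is over the empty set and equals +oo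
   (instead of 1 for an infimum taken in [0, 1]), so that B is uniformly
   convex. *)
Definition modulus_of_convexity (t : R) : \bar R :=
  ereal_inf [set (1 - `|2^-1 *: (xi.1 + xi.2)|)%:E | xi in
    [set xi : B * B | [/\ `|xi.1| = 1, `|xi.2| = 1 & t <= `|xi.1 - xi.2|]]].

Definition uniformly_convex : Prop :=
  forall t : R, 0 < t <= 2 -> (0 < modulus_of_convexity t)%E.

Definition affine_isometry (f : B -> B) : Prop :=
  exists (J : {linear B -> B}) (b : B),
    [/\ bijective J, forall xi, `|J xi| = `|xi| & forall xi, f xi = J xi + b].

Variable G : groupType.

(* As affine isometries are invertible, the second condition implies
   alpha 1 = id: alpha is a homomorphism into the group of affine isometries. *)
Definition isometric_affine_action (alpha : G -> B -> B) : Prop :=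
  (forall g, affine_isometry (alpha g)) /\
  (forall g h, alpha (g * h)%g = alpha g \o alpha h).

Definition proper_action (alpha : G -> B -> B) : Prop :=
  forall (xi : B) (A : set B), bounded_set A ->
    finite_set [set g | A (alpha g xi)].

End Banach.

Section Admissible.
Variables (R : realType) (G : groupType).

Definition admissible (N : nat -> normal_subgroup G) : Prop :=
  [/\ forall n, N n.+1 `<=` N n,
      \bigcap_n N n = [set 1%g]
    & forall n, amenable (quotient_group (N n)) R].

Definition box_family (l : proper_length_function R G)
    (N : nat -> normal_subgroup G) (n : nat) : metricType R :=
  box_space l (N n).

Definition residually_amenable : Prop :=
  [/\ countable [set: G], finitely_generated G & exists N, admissible N].

End Admissible.

(* Main.v *)
Require Import Defs.
From HB Require Import structures.
From mathcomp Require Import all_boot all_order all_algebra.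
From mathcomp Require Import all_classical all_reals all_analysis.
From mathcomp Require Import ring lra.

(** Both directions rest on the fact that, since the ball of radius 4 r in G is
finite and the G_n decrease to the identity, subsets of diameter less than r of
G / G_n lift isometrically to G once n is large; two lifts of the same set
differ by a left translation of G.

From a proper action [alpha] on B, every admissible box family embeds
([action_embedding]). All fibres are copies of B, and over a small set C the
points are represented in G by a lift of C, the section becoming the orbit map
g |-> alpha g 0. The norm of alpha g 0 is controlled by the length of g, from
above because balls of G are finite and from below by properness, and a change
of lift acts by an element of G, hence by an isometry.

Conversely, let a box family embed into B ([embedding_action]). Reading the
fibre over x through the trivialization on the ball of radius k around x gives
isometries T(x, g) of B with T(x, gh) = T(x, g) T(xg, h) whenever the lengths of
g and h add up to at most k ([local_cocycle]); for k large compared with g the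
norm of T(x, g) 0 is at least rho1 (l g). The formula (A_g f)(x) = T(x, g) f(xg) then
defines a partial action of G on the bounded functions from G / G_n to B. It is
isometric for the L^2 seminorm of an invariant mean, which exists by
amenability, and the lower bound on T(x, g) 0, being uniform in x, survives
averaging. Letting k tend to infinity along an ultrafilter turns the partial
actions into an action on a Banach space ([limit_action]).

Three facts make the limit a uniformly convex Banach space with an affine
action. An ultraproduct of seminormed spaces is complete, by a diagonal
argument ([ultraproduct]). Uniform convexity is equivalent to an inequality
between linear combinations of squared norms ([square_convex]), which can be
averaged and passes to limits. Finally, isometries of a uniformly convex space
preserve midpoints and are therefore affine ([mazur_ulam]), so that nothing has
to be known about linear parts before the limit is taken. *)

Set Implicit Arguments.
Unset Strict Implicit.
Unset Printing Implicit Defensive.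

Import Order.TTheory GRing.Theory Num.Theory.
Import numFieldNormedType.Exports.

Local Open Scope classical_set_scope.
Local Open Scope ring_scope.

(** * Separated quotients of complete seminormed spaces *)

Section SeparatedQuotient.
Local Open Scope quotient_scope.
Variables (R : realType) (W : lmodType R).

Record seminorm := Seminorm {
  sn_fun :> W -> R;
  snD : forall x y, sn_fun (x + y) <= sn_fun x + sn_fun y;
  snZ : forall a x, sn_fun (a *: x) = `|a| * sn_fun x }.

Variable p : seminorm.

Lemma sn0 : p 0 = 0.
Proof. by rewrite -(scale0r 0) snZ normr0 mul0r. Qed.

Lemma snN x : p (- x) = p x.
Proof. by rewrite -scaleN1r snZ normrN1 mul1r. Qed.

Lemma sn_ge0 x : 0 <= p x.
Proof. by have := snD p x (- x); rewrite subrr sn0 snN; lra. Qed.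

Lemma snB x y : p (x - y) = p (y - x).
Proof. by rewrite -snN opprB. Qed.

Lemma sn_eq x y : p (x - y) = 0 -> p x = p y.
Proof.
move=> xy; have := snD p (x - y) y; have := snD p (y - x) x.
by rewrite !subrK snB xy; lra.
Qed.

(** A predicate rather than a set, so that the vectors of seminorm zero carry
the closure structure from which the quotient is formed. *)
Definition null : {pred W} := fun x => p x == 0.

Let null_zmod : zmod_closed null.
Proof.
split=> [|x y]; rewrite /in_mem/= /null; first by rewrite sn0.
move=> /eqP px /eqP py; rewrite eq_le sn_ge0 andbT.
by rewrite (le_trans (snD _ _ _))// snN px py addr0.
Qed.

HB.instance Definition _ := GRing.isZmodClosed.Build W null null_zmod.

Definition sepquot : Type := Quotient.quot null.
HB.instance Definition _ := GRing.Zmodule.on sepquot.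
HB.instance Definition _ := EqQuotient.on sepquot.

Definition sepcls (x : W) : sepquot := \pi_sepquot x.

Lemma sepcls_surj (b : sepquot) : sepcls (repr b) = b.
Proof. exact: reprK. Qed.

Lemma sepclsD : {morph sepcls : x y / x + y}.
Proof. by move=> x y; rewrite /sepcls [LHS]pi_addr. Qed.

Lemma sepclsN : {morph sepcls : x / - x}.
Proof. by move=> x; rewrite /sepcls [LHS]pi_oppr. Qed.

Lemma sepcls_eq x y : sepcls x = sepcls y <-> p (x - y) = 0.
Proof.
rewrite /sepcls; split=> [/eqP|xy]; last apply/eqP.
  by rewrite -Quotient.idealrBE => /eqP.
by rewrite -Quotient.idealrBE; apply/eqP.
Qed.

Lemma null_repr x : p (repr (sepcls x) - x) = 0.
Proof. by apply/sepcls_eq; rewrite sepcls_surj. Qed.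

(** The quotient by a closed predicate is only an additive group; its scalar
multiplication is computed on representatives. *)
Definition sepscale (a : R) (b : sepquot) : sepquot := sepcls (a *: repr b).

Lemma sepscaleE a x : sepscale a (sepcls x) = sepcls (a *: x).
Proof.
by apply/sepcls_eq; rewrite -scalerBr snZ null_repr mulr0.
Qed.

Let sepscaleA a b v : sepscale a (sepscale b v) = sepscale (a * b) v.
Proof. by rewrite -[v]sepcls_surj !sepscaleE scalerA. Qed.
Let sepscale1 : left_id 1 sepscale.
Proof. by move=> v; rewrite -[v]sepcls_surj !sepscaleE scale1r. Qed.
Let sepscaleDr : right_distributive sepscale +%R.
Proof.
move=> a u v; rewrite -[v]sepcls_surj -[u]sepcls_surj -sepclsD !sepscaleE.
by rewrite scalerDr sepclsD.
Qed.
Let sepscaleDl v : {morph sepscale^~ v : a b / a + b}.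
Proof.
by move=> a b; rewrite -[v]sepcls_surj !sepscaleE scalerDl sepclsD.
Qed.

HB.instance Definition _ := GRing.Zmodule_isLmodule.Build R sepquot
  sepscaleA sepscale1 sepscaleDr sepscaleDl.

Lemma sepclsZ a x : sepcls (a *: x) = a *: sepcls x.
Proof. by rewrite -sepscaleE. Qed.

Definition sepnorm (b : sepquot) : R := p (repr b).

Lemma sepnormE x : sepnorm (sepcls x) = p x.
Proof. exact/sn_eq/null_repr. Qed.

Let sepnormD (x y : sepquot) : sepnorm (x + y) <= sepnorm x + sepnorm y.
Proof.
rewrite -[x]sepcls_surj -[y]sepcls_surj -sepclsD !sepnormE; exact: snD.
Qed.
Let sepnormZ (a : R) (x : sepquot) : sepnorm (a *: x) = `|a| * sepnorm x.
Proof. by rewrite -[x]sepcls_surj -sepclsZ !sepnormE snZ. Qed.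
Let sepnorm_eq0 (x : sepquot) : sepnorm x = 0 -> x = 0.
Proof.
rewrite -[x]sepcls_surj sepnormE => x0.
have -> : 0 = sepcls 0 by rewrite -(scale0r (0 : W)) sepclsZ scale0r.
by apply/sepcls_eq; rewrite subr0.
Qed.

HB.instance Definition _ := Lmodule_isNormed.Build R sepquot
  sepnormD sepnormZ sepnorm_eq0.

Lemma norm_sepcls x : `|sepcls x| = p x.
Proof. exact: sepnormE. Qed.

End SeparatedQuotient.

(** Only sequences with geometrically small steps are tested, and the limit
comes with a rate: this is what the diagonal argument for ultraproducts
produces, and it suffices because every Cauchy filter on a seminormed space is
controlled by such a sequence. *)
Definition seq_complete (R : realType) (W : lmodType R) (p : W -> R) : Prop :=
  forall w : nat -> W, (forall j, p (w j.+1 - w j) <= 2^-1 ^+ j) ->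
    exists x, forall j, p (x - w j) <= 4 * 2^-1 ^+ j.

(** Choosing in the Cauchy filter balls of radius 2^-j / 4 makes consecutive
centres less than 2^-j apart, so [seq_complete] applies to their
representatives, and the limit of the centres is the limit of the filter. *)
Lemma sepquot_complete (R : realType) (W : lmodType R) (p : seminorm W)
    (pc : seq_complete p) (F : set_system (sepquot p)) :
  ProperFilter F -> cauchy F -> cvg F.
Proof.
move=> FF /cauchyP Fc.
have e0 j : 0 < 4^-1 * 2^-1 ^+ j :> R by rewrite mulr_gt0// exprn_gt0.
pose y j := projT1 (cid (Fc _ (e0 j))).
have yF j : F (ball (y j) (4^-1 * 2^-1 ^+ j)) := projT2 (cid (Fc _ (e0 j))).
have [x xy] : exists x : W, forall j, p (x - repr (y j)) <= 4 * 2^-1 ^+ j.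
  apply: pc => j; rewrite -norm_sepcls sepclsD sepclsN !sepcls_surj.
  have [z []] := filter_ex (filterI (yF j) (yF j.+1)).
  rewrite -ball_normE /ball_/= => z1 z2.
  have -> : y j.+1 - y j = (y j.+1 - z) - (y j - z).
    by rewrite opprB addrA subrK.
  rewrite (le_trans (ler_normB _ _))//.
  have : 0 < 2^-1 ^+ j :> R by rewrite exprn_gt0.
  move: z1 z2; rewrite exprS; lra.
apply/cvg_ex; exists (sepcls p x); apply/fcvgrPdist_lt => e egt0.
have [j je] : exists j, 5 * 2^-1 ^+ j < e.
  have /cvgrPdist_lt/(_ (e / 5)) : (2^-1 ^+ j : R) @[j --> \oo] --> 0.
    by apply: cvg_expr; rewrite ger0_norm; lra.
  case=> [|j _ /(_ j)]; first by rewrite divr_gt0.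
  rewrite /= sub0r normrN ger0_norm ?exprn_ge0// => /(_ (leqnn _)) h.
  by exists j; lra.
apply: filterS (yF j) => z; rewrite -ball_normE /ball_/= => yz.
have -> : sepcls p x - z = (sepcls p x - y j) + (y j - z).
  by rewrite addrA subrK.
rewrite (le_lt_trans (ler_normD _ _))//.
have : `|sepcls p x - y j| <= 4 * 2^-1 ^+ j.
  by rewrite -{1}[y j]sepcls_surj -sepclsN -sepclsD norm_sepcls.
have : 0 < 2^-1 ^+ j :> R by rewrite exprn_gt0.
lra.
Qed.

(** The map [c] is all that is used of the separated quotient from here on. *)
Lemma banach_quotient (R : realType) (W : lmodType R) (p : seminorm W) :
  seq_complete p ->
  exists (B : completeNormedModType R) (c : W -> B),
    [/\ {morph c : x y / x + y}, (forall a x, c (a *: x) = a *: c x),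
        (forall b, exists x, c x = b) & forall x, `|c x| = p x].
Proof.
move=> pc.
pose B : completeNormedModType R := HB.pack (sepquot p)
  (Uniform_isComplete.Build (sepquot p) (sepquot_complete pc)).
exists B, (sepcls p); split.
- exact: sepclsD.
- exact: sepclsZ.
- by move=> b; exists (repr b); exact: sepcls_surj.
- exact: norm_sepcls.
Qed.

(** * Uniform convexity as an inequality between squares *)

Section SquareConvexity.
Variable R : realType.

(** A quantitative form of uniform convexity for the function [p] on [D]: it is
an inequality between linear combinations of squares of [p], so that, unlike
a bound on unit vectors, it can be averaged and passes to limits. *)
Definition square_convex_with (W : lmodType R) (p : W -> R) (D : set W)
    (e K : R) : Prop :=
  forall x y, D x -> D y ->
    p (x - y) ^+ 2 <= e * (p x ^+ 2 + p y ^+ 2) +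
      K * ((p x ^+ 2 + p y ^+ 2) / 2 - p (2^-1 *: (x + y)) ^+ 2).

Definition square_convex (V : normedModType R) : Prop :=
  forall e, 0 < e -> exists2 K, 0 < K &
    square_convex_with (fun x : V => `|x|) setT e K.

Lemma modulus_pos (B : completeNormedModType R) (t : R) :
  (0 < modulus_of_convexity B t)%E -> exists2 d, 0 < d <= 1 &
    forall x y : B, `|x| = 1 -> `|y| = 1 -> t <= `|x - y| ->
      `|2^-1 *: (x + y)| <= 1 - d.
Proof.
move=> m0.
have [d [d0 d1 dm]] : exists d : R,
    [/\ 0 < d, d <= 1 & (d%:E <= modulus_of_convexity B t)%E].
  case: (modulus_of_convexity B t) m0 => [m|_|//].
  - rewrite lte_fin => m0; exists (Num.min m 1); rewrite lt_min m0 ltr01/=.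
    by rewrite ge_min lexx orbT lee_fin ge_min lexx.
  - by exists 1; rewrite ltr01 lexx leey.
exists d => [|x y x1 y1 xy]; first by rewrite d0.
have : (d%:E <= (1 - `|2^-1 *: (x + y)|)%:E)%E.
  by apply: le_trans dm _; apply: ereal_inf_lbound; exists (x, y).
rewrite lee_fin; lra.
Qed.

(** The gap between the mean of the squares and the square of the mean comes
from the norms of [x] and [y] if they differ by at least [u], and otherwise
from uniform convexity applied to [x] and the normalization of [y]. *)
Lemma uniformly_convex_gap (B : completeNormedModType R) (e : R) :
  uniformly_convex B -> 0 < e -> exists2 c, 0 < c &
    forall x y : B, `|x| = 1 -> `|y| <= 1 -> e < `|x - y| ^+ 2 ->
      c <= (1 + `|y| ^+ 2) / 2 - `|2^-1 *: (x + y)| ^+ 2.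
Proof.
move=> ucB e0; have [n n0 ne] : exists2 n, 0 < n & n ^+ 2 = e.
  by exists (Num.sqrt e); rewrite ?sqrtr_gt0// sqr_sqrtr// ltW.
pose t := Num.min (n / 2) 1.
have t0 : 0 < t <= 2.
  by rewrite lt_min divr_gt0//= ltr01/= ge_min; apply/orP; right; lra.
have [d /andP[d0 d1] dP] := modulus_pos (ucB _ t0).
pose u := Num.min (n / 2) (d / 2).
have u0 : 0 < u by rewrite lt_min !divr_gt0.
have un : u <= n / 2 by rewrite ge_min lexx.
have ud : u <= d / 2 by rewrite ge_min lexx orbT.
have tn : t <= n / 2 by rewrite ge_min lexx.
exists (Num.min (u ^+ 2 / 4) (d / 4)) => [|x y x1 y1 xy].
  by rewrite lt_min !divr_gt0// exprn_gt0.
set s := `|2^-1 *: (x + y)|.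
have s0 : 0 <= s by exact: normr_ge0.
have ny0 : 0 <= `|y| by exact: normr_ge0.
(* If |y| <= 1 - u, the gap is at least (1 - |y|)^2 / 4. *)
have [yu|yu] := leP `|y| (1 - u).
  have sy : s <= (1 + `|y|) / 2.
    rewrite /s normrZ ger0_norm// mulrC ler_wpM2r// -{1}x1.
    exact: ler_normD.
  have : s ^+ 2 <= ((1 + `|y|) / 2) ^+ 2 by rewrite lerXn2r ?nnegrE //; lra.
  have : u ^+ 2 <= (1 - `|y|) ^+ 2 by rewrite lerXn2r ?nnegrE //; lra.
  rewrite ge_min => h1 h2; apply/orP; left.
  by move: h1 h2; rewrite !expr2; nra.
(* Otherwise y is within u of the unit vector y' = y / |y|. *)
have y0 : 0 < `|y| by lra.
have nxy : n <= `|x - y|.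
  by rewrite -(@ler_pXn2r _ 2)// ?nnegrE ?normr_ge0 ?ne ?ltW.
pose y' := `|y|^-1 *: y.
have y'1 : `|y'| = 1 by rewrite normrZ normfV normr_id mulVf// gt_eqF.
have yy' : `|y' - y| = 1 - `|y|.
  have -> : y' - y = (1 - `|y|) *: y'.
    rewrite scalerBl scale1r /y' [in X in _ = _ - X]scalerA mulfV ?gt_eqF//.
    by rewrite scale1r.
  by rewrite normrZ y'1 mulr1 ger0_norm; lra.
have txy' : t <= `|x - y'|.
  have : `|x - y| <= `|x - y'| + `|y' - y| by exact: ler_distD.
  rewrite yy'; lra.
have sd : s <= 1 - d / 2.
  have -> : s = `|2^-1 *: (x + y') - 2^-1 *: (y' - y)|.
    by rewrite -scalerBr opprB addrCA addrK addrC.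
  rewrite (le_trans (ler_normB _ _))//.
  have := dP x y' x1 y'1 txy'; rewrite (normrZ _ (y' - y)) yy' ger0_norm//.
  lra.
have : s ^+ 2 <= (1 - d / 2) ^+ 2 by rewrite lerXn2r ?nnegrE //; lra.
have : (1 - u) ^+ 2 <= `|y| ^+ 2 by rewrite lerXn2r ?nnegrE //; lra.
rewrite ge_min => h1 h2; apply/orP; right.
by move: h1 h2; rewrite !expr2; nra.
Qed.

(** By homogeneity [x] may be taken of norm 1 and [y] of norm at most 1. Either
|x - y|^2 is already bounded by the first term, or the gap is at least c while
|x - y|^2 <= 4, whence K = 4 / c. *)
Lemma uniformly_convex_square (B : completeNormedModType R) :
  uniformly_convex B -> square_convex B.
Proof.
move=> ucB e e0; have [c c0 cP] := uniformly_convex_gap ucB e0.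
exists (4 / c) => [|x y _ _]; first by rewrite divr_gt0.
wlog yx : x y / `|y| <= `|x|.
  move=> h; have [/h//|/ltW/h] := leP `|y| `|x|.
  by rewrite distrC [y + x]addrC [`|y| ^+ 2 + _]addrC.
set a := `|x| in yx *; set b := `|y| in yx *; set s := `|_ *: _|.
have s0 : 0 <= s by exact: normr_ge0.
have b0 : 0 <= b by exact: normr_ge0.
have sy : s <= (a + b) / 2.
  by rewrite /s normrZ ger0_norm// mulrC ler_wpM2r// ler_normD.
have gap0 : 0 <= (a ^+ 2 + b ^+ 2) / 2 - s ^+ 2.
  have : s ^+ 2 <= ((a + b) / 2) ^+ 2 by rewrite lerXn2r ?nnegrE //; lra.
  have := sqr_ge0 (a - b); rewrite !expr2; nra.
have K0 : 0 < 4 / c by rewrite divr_gt0.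
have [xye|xye] := leP (`|x - y| ^+ 2) (e * (a ^+ 2 + b ^+ 2)).
  by rewrite (le_trans xye)// lerDl mulr_ge0// ltW.
have a0 : 0 < a.
  rewrite lt_neqAle normr_ge0 andbT eq_sym; apply/negP => /eqP a0.
  move: xye; have b0' : b = 0 by apply/eqP; rewrite eq_le b0 andbT -a0.
  by rewrite (normr0_eq0 a0) (normr0_eq0 b0') a0 b0' subrr normr0 expr0n/=; lra.
have ae x' : `|a^-1 *: x'| = `|x'| / a.
  by rewrite normrZ normfV (ger0_norm (ltW a0)) mulrC.
have := cP (a^-1 *: x) (a^-1 *: y).
rewrite -scalerBr -scalerDr [2^-1 *: _]scalerA [2^-1 * _]mulrC.
rewrite -scalerA !ae divff ?gt_eqF// -/a -/b -/s => h.
have {h} cs : c * a ^+ 2 <= (a ^+ 2 + b ^+ 2) / 2 - s ^+ 2.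
  have -> : (a ^+ 2 + b ^+ 2) / 2 - s ^+ 2 =
      ((1 + (b / a) ^+ 2) / 2 - (s / a) ^+ 2) * a ^+ 2.
    by field; rewrite gt_eqF.
  apply: ler_wpM2r; first exact: sqr_ge0.
  apply: h => //; first by rewrite ler_pdivrMr// mul1r.
  rewrite expr_div_n ltr_pdivlMr ?exprn_gt0//.
  by apply: le_lt_trans xye; rewrite ler_wpM2l ?(ltW e0)// lerDl sqr_ge0.
have xy4 : `|x - y| ^+ 2 <= 4 * a ^+ 2.
  have : `|x - y| <= 2 * a by rewrite (le_trans (ler_normB _ _))// -/a -/b; lra.
  move=> h; have : `|x - y| ^+ 2 <= (2 * a) ^+ 2.
    by rewrite lerXn2r ?nnegrE //; lra.
  by rewrite exprMn; lra.
have : 4 * a ^+ 2 <= 4 / c * ((a ^+ 2 + b ^+ 2) / 2 - s ^+ 2).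
  by rewrite -mulrA ler_wpM2l// ler_pdivlMl.
have : 0 <= e * (a ^+ 2 + b ^+ 2).
  by rewrite mulr_ge0 ?addr_ge0 ?sqr_ge0 ?(ltW e0).
lra.
Qed.

(** On unit vectors at distance at least t, taking e = t^2 / 4 leaves
t^2 / 2 <= K (1 - s^2) with s the norm of the midpoint. *)
Lemma square_uniformly_convex (B : completeNormedModType R) :
  square_convex B -> uniformly_convex B.
Proof.
move=> scB t /andP[t0 t2].
have [|K K0 KP] := scB (t ^+ 2 / 4); first by rewrite divr_gt0// exprn_gt0.
apply: (@lt_le_trans _ _ (t ^+ 2 / (4 * K))%:E).
  by rewrite lte_fin divr_gt0 ?exprn_gt0// mulr_gt0.
apply: le_ereal_inf_tmp => _ [[x y] /= [x1 y1 xy] <-]; rewrite lee_fin.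
have := KP x y I I; rewrite x1 y1 expr1n; set s := `|_ *: _| => h.
have s0 : 0 <= s by exact: normr_ge0.
have s1 : s <= 1.
  rewrite /s normrZ ger0_norm//; have := ler_normD x y; rewrite x1 y1; lra.
have : t ^+ 2 <= `|x - y| ^+ 2 by rewrite lerXn2r ?nnegrE ?normr_ge0 ?(ltW t0).
rewrite ler_pdivrMr ?mulr_gt0// => h2.
have : 0 <= K * (1 - s) ^+ 2 by rewrite mulr_ge0 ?sqr_ge0 ?(ltW K0).
move: h h2; rewrite !expr2; nra.
Qed.

End SquareConvexity.

(** * Isometries of uniformly convex spaces are affine *)

Section MazurUlam.
Variables (R : realType) (B : completeNormedModType R).
Hypothesis scB : square_convex B.

(** The gap vanishes for [u] and [v], so |u - v|^2 <= 2 e d^2 for every e. *)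
Lemma midpoint_unique (u v : B) (d : R) :
  `|u| = d -> `|v| = d -> `|u + v| = 2 * d -> u = v.
Proof.
move=> ud vd uvd; apply/eqP; rewrite -subr_eq0 -normr_le0.
have h e : 0 < e -> `|u - v| ^+ 2 <= e * (2 * d ^+ 2).
  move=> e0; have [K K0 KP] := scB e0.
  have := KP u v I I; rewrite ud vd normrZ uvd ger0_norm//.
  rewrite [2^-1 * _]mulrC [2 * d]mulrC mulfK ?pnatr_eq0//; lra.
have d2 : 0 <= d ^+ 2 by exact: sqr_ge0.
rewrite leNgt; apply/negP => uv0.
have uv2 : 0 < `|u - v| ^+ 2 by rewrite exprn_gt0.
have d2' : 0 < 2 * d ^+ 2 + 1 by lra.
have := h (`|u - v| ^+ 2 / (2 * d ^+ 2 + 1)) (divr_gt0 uv2 d2').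
rewrite mulrAC ler_pdivlMr//; nra.
Qed.

Variable T : B -> B.
Hypothesis Tiso : forall x y, `|T x - T y| = `|x - y|.

Let J x := T x - T 0.

Let J0 : J 0 = 0. Proof. by rewrite /J subrr. Qed.

Let Jiso x y : `|J x - J y| = `|x - y|.
Proof. by rewrite /J opprB addrA subrK Tiso. Qed.

Let Jnorm x : `|J x| = `|x|.
Proof. by rewrite -[J x]subr0 -J0 Jiso subr0. Qed.

(** The midpoint of [x] and [y] is the only point at distance |x - y| / 2 from
both, by [midpoint_unique]; hence isometries preserve midpoints. *)
Let Jmid x y : J (2^-1 *: (x + y)) = 2^-1 *: (J x + J y).
Proof.
set z := 2^-1 *: (x + y).
have half (a b : B) : a - 2^-1 *: (a + b) = 2^-1 *: (a - b).
  rewrite scalerDr opprD addrA scalerBr; congr (_ - _).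
  by rewrite -{1}[a]scale1r -scalerBl; congr (_ *: _); lra.
have xz : x - z = 2^-1 *: (x - y) by exact: half.
have zy : z - y = 2^-1 *: (x - y).
  by rewrite -opprB /z [x + y]addrC half -scalerN opprB.
have e : J x - J z = J z - J y.
  apply: (@midpoint_unique _ _ (2^-1 * `|x - y|)).
  - by rewrite Jiso xz normrZ ger0_norm.
  - by rewrite Jiso zy normrZ ger0_norm.
  - by rewrite addrA subrK Jiso mulrA divff ?mul1r// pnatr_eq0.
have -> : J x + J y = 2 *: J z.
  by rewrite scaler_nat mulr2n -[J x](subrK (J z)) e addrAC subrK.
by rewrite scalerA mulVf ?scale1r// pnatr_eq0.
Qed.

Let Jhalf x : J (2^-1 *: x) = 2^-1 *: J x.
Proof. by have := Jmid x 0; rewrite J0 !addr0. Qed.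

Let JD : {morph J : x y / x + y}.
Proof.
move=> x y; have := Jmid x y; rewrite Jhalf => /(congr1 (fun v => 2 *: v)).
by rewrite !scalerA divff ?scale1r// pnatr_eq0.
Qed.

Let JMn x n : J (x *+ n) = J x *+ n.
Proof. by elim: n => [|n ih]; rewrite ?mulr0n// !mulrS JD ih. Qed.

Let JN x : J (- x) = - J x.
Proof. by apply/eqP; rewrite -addr_eq0 -JD addNr J0. Qed.

(** Write (n + 1) r = m + t with m natural and 0 <= t < 1: additivity turns
(n + 1) (J (r x) - r J x) into J (t x) - t J x, of norm at most 2 |x|, for
every n. *)
Let JZ_ge0 r x : 0 <= r -> J (r *: x) = r *: J x.
Proof.
move=> r0; apply/eqP; rewrite -subr_eq0 -normr_le0.
have h n : n.+1%:R * `|J (r *: x) - r *: J x| <= 2 * `|x|.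
  have nr0 : 0 <= r *+ n.+1 by rewrite mulrn_wge0.
  pose m := Num.truncn (r *+ n.+1).
  have [t tE] : exists t, t = r *+ n.+1 - m%:R by eexists.
  have /andP[m1 m2] := truncn_itv nr0.
  rewrite mulr_natl -normrMn mulrnBl -JMn !scalerMnl.
  have -> : r *+ n.+1 = m%:R + t by rewrite tE addrC subrK.
  rewrite !scalerDl !scaler_nat JD JMn opprD addrACA subrr add0r.
  apply: (le_trans (ler_normB _ _)); rewrite Jnorm !normrZ Jnorm -mulrDl.
  rewrite -/m in m1 m2; apply: ler_wpM2r; first exact: normr_ge0.
  rewrite ger0_norm; last by rewrite tE subr_ge0.
  move: m2; rewrite tE -natr1; lra.
rewrite leNgt; apply/negP; set c := `|_| in h * => c0.
have := h (Num.truncn (2 * `|x| / c)).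
have := truncnS_gt (2 * `|x| / c); rewrite ltr_pdivrMr// => h1 h2.
by have := lt_le_trans h1 h2; rewrite ltxx.
Qed.

Let JZ r x : J (r *: x) = r *: J x.
Proof.
have [/JZ_ge0//|/ltW r0] := leP 0 r.
by rewrite -{1}[r]opprK scaleNr JN JZ_ge0 ?oppr_ge0 // scaleNr opprK.
Qed.

Let J_linear : linear J.
Proof. by move=> a x y; rewrite JD JZ. Qed.

HB.instance Definition _ := GRing.isLinear.Build R B B *:%R J J_linear.

(** The Mazur-Ulam theorem, in the form that it takes in strictly convex
spaces. *)
Lemma mazur_ulam : bijective T -> affine_isometry T.
Proof.
move=> [S TK SK]; exists J, (T 0); split=> [|//|xi]; last by rewrite /J subrK.
exists (fun y => S (y + T 0)) => y.
- by rewrite /= /J subrK TK.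
- by rewrite /= /J SK addrK.
Qed.

End MazurUlam.

(** * Ultraproducts of seminormed spaces *)

(** Non-principality is stated as: every tail belongs to [U]. *)
Lemma ultrafilter_oo : exists U : set_system nat,
  UltraFilter U /\ (forall n, U [set k | (n <= k)%N]).
Proof.
have [U [UU ooU]] := @ultraFilterLemma nat \oo _.
by exists U; split=> // n; apply: ooU; exact: nbhs_infty_ge.
Qed.

Lemma ultra_bounded_cvg (R : realType) (U : set_system nat) (u : nat -> R)
    (C : R) :
  UltraFilter U -> (forall k, 0 <= u k <= C) -> cvg (u k @[k --> U]).
Proof.
move=> UU uC.
have VU : UltraFilter (u k @[k --> U]).
  split=> [|G GP uG]; first exact: fmap_proper_filter.
  apply/seteqP; split=> // A GA.
  have [//|UA] := in_ultra_setVsetC (u @^-1` A) UU.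
  have [x [Ax nAx]] := filter_ex (filterI GA (uG (~` A) UA)).
  by [].
have [x [_ ux]] : `[0, C]%classic `&` [set x | u k @[k --> U] --> x] !=set0.
  have := @segment_compact R 0 C; rewrite compact_ultra; apply => //.
  by apply: (@filterE _ U) => k; rewrite /= in_itv/=.
by apply/cvg_ex; exists x.
Qed.

(** The seminorms [N k] need only be seminorms on the common domain [D]. The
hypothesis [glue] says that [D] contains every family obtained by choosing its
[k]-th component, as seen by [N k], from a different vector [F k]; it holds for
functions on a disjoint union and is what makes the limit complete. *)
Section Ultraproduct.
Variables (R : realType) (E : lmodType R) (D : set E) (N : nat -> E -> R).
Hypothesis D0 : D 0.
Hypothesis DL : forall a x y, D x -> D y -> D (a *: x + y).
Hypothesis ND : forall k x y, D x -> D y -> N k (x + y) <= N k x + N k y.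
Hypothesis NZ : forall k a x, D x -> N k (a *: x) = `|a| * N k x.
Hypothesis glue : forall F : nat -> E, (forall j, D (F j)) ->
  exists2 x, D x & forall k, N k (x - F k) = 0.

Let DB x y : D x -> D y -> D (x - y).
Proof. by move=> Dx Dy; rewrite addrC -scaleN1r; exact: DL. Qed.

Let NN k x : D x -> N k (- x) = N k x.
Proof. by move=> Dx; rewrite -scaleN1r NZ// normrN1 mul1r. Qed.

Let Nge0 k x : D x -> 0 <= N k x.
Proof.
move=> Dx; have DNx : D (- x) by rewrite -sub0r; exact: DB.
have := ND k Dx DNx; rewrite subrr NN//.
have -> : N k 0 = 0 by rewrite -(scale0r 0) NZ// normr0 mul0r.
lra.
Qed.

Definition uniformly_bounded : set E :=
  [set x | D x /\ exists C, forall k, N k x <= C].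

Let tame : {pred E} := [in uniformly_bounded].

Let tameP x : reflect (uniformly_bounded x) (x \in tame).
Proof. by apply: (iffP idP) => [/set_mem|/mem_set]. Qed.

Let tame_submod : submod_closed tame.
Proof.
split=> [|a x y /tameP[Dx [C xC]] /tameP[Dy [C' yC]]]; apply/tameP.
  by split=> //; exists 0 => k; rewrite -(scale0r 0) NZ// normr0 mul0r.
split; first exact: DL.
exists (`|a| * C + C') => k; have Dax : D (a *: x).
  by rewrite -[a *: x]addr0; exact: DL.
by rewrite (le_trans (ND _ _ _))// NZ// lerD// ler_wpM2l.
Qed.

HB.instance Definition _ := GRing.isSubmodClosed.Build R E tame tame_submod.

Let W : Type := {x : E | x \in tame}.
HB.instance Definition _ := SubChoice.on W.
HB.instance Definition _ := [SubChoice_isSubLmodule of W by <:].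

Variable U : set_system nat.
Hypothesis UU : UltraFilter U.
Hypothesis Uoo : forall n, U [set k | (n <= k)%N].

Let unorm (w : W) : R := lim (N k (val w) @[k --> U]).

Let WD (w : W) : D (val w).
Proof. by have /tameP[] := valP w. Qed.

Let unorm_cvg (w : W) : N k (val w) @[k --> U] --> unorm w.
Proof.
have /tameP[Dw [C wC]] := valP w.
by apply: (@ultra_bounded_cvg _ _ _ C) => k; rewrite Nge0//= wC.
Qed.

Let unormD x y : unorm (x + y) <= unorm x + unorm y.
Proof.
have xy : N k (val x) + N k (val y) @[k --> U] --> unorm x + unorm y.
  by apply: cvgD; exact: unorm_cvg.
apply: (ler_cvg_to (@unorm_cvg (x + y)) xy).
by apply: nearW => k; exact: ND.
Qed.

Let unormZ a x : unorm (a *: x) = `|a| * unorm x.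
Proof.
have ax : `|a| * N k (val x) @[k --> U] --> `|a| * unorm x.
  by apply: cvgMl_tmp; exact: unorm_cvg.
apply: (@cvg_unique _ (@Rhausdorff R) (N k (val (a *: x)) @[k --> U])).
  exact: unorm_cvg.
by apply: cvg_trans ax; apply: near_eq_cvg; apply: nearW => k; rewrite -NZ.
Qed.

Let p : seminorm W := Seminorm unormD unormZ.

(** Countable saturation. The set [A j] consists of the indices at which the
first [j] steps of the sequence are small, and belongs to [U]. At index [k] the
limit copies the term of the sequence of the last rank [J k] such that [k] is
in [A (J k)]; that rank exists because [A j] starts at [j]. *)
Let unorm_complete : seq_complete unorm.
Proof.
move=> w ww; pose e j : R := 2^-1 ^+ j.
have e0 j : 0 < e j by rewrite exprn_gt0.
(* At most 2 e j: the limit is at most e j, and strictness is needed to pass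
from the limit to a set of indices in U. *)
pose A j := [set k | (j <= k)%N /\
  forall i, (i < j)%N -> N k (val (w i.+1) - val (w i)) <= 2 * e i].
have AU j : U (A j).
  elim: j => [|j ih]; first by apply: filterE => k; split.
  have wj : \forall k \near U, N k (val (w j.+1 - w j)) <= 2 * e j.
    apply: cvgr_le (@unorm_cvg (w j.+1 - w j)) _ _.
    by have := ww j; have := e0 j; rewrite /e; lra.
  apply: filterS (filterI (Uoo j.+1) (filterI ih wj)).
  move=> k [/= jk [[_ kj] wjk]]; split=> // i; rewrite ltnS leq_eqVlt.
  by move=> /predU1P[->|/kj//].
have tele j m k : A (j + m)%N k ->
    N k (val (w (j + m)%N) - val (w j)) <= 4 * (e j - e (j + m)%N).
  elim: m => [|m ih].
    by rewrite addn0 !subrr mulr0 -(scale0r 0) NZ// normr0 mul0r.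
  rewrite addnS => -[jk kA].
  have /ih {}ih : A (j + m)%N k.
    by split=> [|i /ltnW ij]; [exact: ltnW | apply: kA].
  have := kA _ (leqnn _); rewrite /e exprS -/(e _) => h.
  rewrite -(subrK (val (w (j + m)%N)) (val (w (j + m).+1))) -addrA.
  rewrite (le_trans (ND _ _ _))//; do ?exact: DB.
  by move: h ih; rewrite /e; lra.
have Jex k : exists j, A j k /\ forall i, A i k -> (i <= j)%N.
  have A0 : exists j, `[< A j k >] by exists 0; apply/asboolP; split.
  have Ak j : `[< A j k >] -> (j <= k)%N by move=> /asboolP[].
  have [j /asboolP Aj jmax] := ex_maxnP A0 Ak.
  by exists j; split=> // i Ai; apply/jmax/asboolP.
pose J k := projT1 (cid (Jex k)).
have [x Dx xJ] := glue (fun k => WD (w (J k))).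
have xw j k : A j k -> N k (x - val (w j)) <= 4 * e j.
  move=> Ajk; have [AJ /(_ _ Ajk) jJ] := projT2 (cid (Jex k)).
  rewrite -/(J k) in AJ jJ.
  have := tele j (J k - j)%N k; rewrite subnKC// => /(_ AJ) h.
  rewrite -(subrK (val (w (J k))) x) -addrA.
  rewrite (le_trans (ND _ _ _)) ?xJ ?add0r//; do ?exact: DB.
  by have := e0 (J k); lra.
have xt : x \in tame.
  apply/tameP; split=> //; have /tameP[_ [C wC]] := valP (w 0%N).
  exists (4 + C) => k; rewrite -(subrK (val (w 0%N)) x).
  rewrite (le_trans (ND _ _ _))//; first exact: DB.
  have := xw 0%N k; rewrite /e expr0 mulr1 => h.
  by rewrite lerD// h//; split.
exists (exist _ x xt : W) => j.
apply: (ler_cvg_to (@unorm_cvg _) (cvg_cst (4 * e j))).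
by apply: filterS (AU j) => k /xw.
Qed.

(** Ultraproducts along a non-principal ultrafilter are complete even if their
factors are not. The map [c] is meaningful on uniformly bounded vectors only. *)
Lemma ultraproduct : exists (B : completeNormedModType R) (c : E -> B),
  [/\ forall x y, uniformly_bounded x -> uniformly_bounded y ->
        c (x + y) = c x + c y,
      forall a x, uniformly_bounded x -> c (a *: x) = a *: c x,
      forall b, exists2 x, uniformly_bounded x & c x = b
    & forall x, uniformly_bounded x -> N k x @[k --> U] --> `|c x|].
Proof.
have [B [c [cD cZ cS cN]]] := banach_quotient (p := p) unorm_complete.
have iK x : uniformly_bounded x -> val (insubd (0 : W) x) = x.
  by move=> xt; rewrite insubdK//; apply/tameP.
exists B, (fun x => c (insubd (0 : W) x)); split.
- move=> x y xt yt; rewrite -cD; congr c; apply: val_inj.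
  by rewrite [RHS]/= !iK//; apply/tameP; apply: rpredD; exact/tameP.
- move=> a x xt; rewrite -cZ; congr c; apply: val_inj.
  by rewrite [RHS]/= !iK//; apply/tameP; apply: rpredZ; exact/tameP.
- move=> b; have [x <-] := cS b; exists (val x); first exact/tameP/valP.
  by congr c; apply: val_inj; rewrite iK//; exact/tameP/valP.
- by move=> x xt; rewrite cN -{1}(iK x xt); exact: unorm_cvg.
Qed.

End Ultraproduct.

(** * The square norm of an invariant mean *)

Lemma bounded_fun_bound (R : realType) (X : Type) (f : X -> R) :
  bounded_fun f <-> exists C, forall x, `|f x| <= C.
Proof.
split=> [fb|[C fC]].
  have [C Cf] := @filter_ex _ (pinfty_nbhs R) _ _ fb.
  by exists C => x; exact: Cf.
exists C; split=> [|M CM x _]; first exact: num_real.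
exact: le_trans (fC x) (ltW CM).
Qed.

Section Mean.
Variables (R : realType) (X : Type).

Record mean := Mean {
  mean_fun :> (X -> R) -> R;
  mean_linear : forall (a : R) (f g : X -> R), bounded_fun f -> bounded_fun g ->
    mean_fun (fun x => a * f x + g x) = a * mean_fun f + mean_fun g;
  mean_ge0 : forall f : X -> R, bounded_fun f -> (forall x, 0 <= f x) ->
    0 <= mean_fun f;
  mean1 : mean_fun (fun=> 1) = 1 }.

Variable m : mean.

Let bcst (c : R) : bounded_fun (fun _ : X => c).
Proof. by apply/bounded_fun_bound; exists `|c|. Qed.

Let bcomb a b (f g : X -> R) : bounded_fun f -> bounded_fun g ->
  bounded_fun (fun x => a * f x + b * g x).
Proof.
move=> /bounded_fun_bound[C fC] /bounded_fun_bound[C' gC].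
apply/bounded_fun_bound.
exists (`|a| * C + `|b| * C') => x; rewrite (le_trans (ler_normD _ _))//.
by rewrite !normrM lerD// ler_wpM2l.
Qed.

Lemma mean_comb a b (f g : X -> R) : bounded_fun f -> bounded_fun g ->
  m (fun x => a * f x + b * g x) = a * m f + b * m g.
Proof.
move=> fb gb; have m0 : m (fun=> 0) = 0.
  have := mean_linear m 1 (bcst 0) (bcst 0).
  by under eq_fun do rewrite mulr0 addr0; lra.
have bg : m (fun x => b * g x) = b * m g.
  have := mean_linear m b gb (bcst 0); rewrite m0 addr0 => <-.
  by congr (m _); apply/funext => x; rewrite addr0.
rewrite mean_linear// ?bg//.
have := bcomb 0 b gb gb; congr bounded_fun.
by apply/funext => x; rewrite mul0r add0r.
Qed.

Lemma mean_cst c : m (fun=> c) = c.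
Proof.
by have := mean_comb c 0 (bcst 1) (bcst 1); rewrite mean1 mulr1 !mul0r !addr0.
Qed.

Lemma mean_le (f g : X -> R) : bounded_fun f -> bounded_fun g ->
  (forall x, f x <= g x) -> m f <= m g.
Proof.
move=> fb gb fg; rewrite -subr_ge0.
have := mean_comb (-1) 1 fb gb; rewrite mulN1r mul1r addrC => <-.
apply: mean_ge0 => [|x]; first exact: bcomb.
by rewrite mulN1r mul1r addrC subr_ge0.
Qed.

Section MeanNorm.
Variable V : normedModType R.
Implicit Types F H : X -> V.

Definition bounded_map F : Prop := exists C, forall x, `|F x| <= C.

Definition mean_norm F : R := Num.sqrt (m (fun x => `|F x| ^+ 2)).

Lemma sqr_norm_bounded F : bounded_map F -> bounded_fun (fun x => `|F x| ^+ 2).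
Proof.
move=> [C FC]; apply/bounded_fun_bound; exists (C ^+ 2) => x.
by rewrite ger0_norm ?sqr_ge0// lerXn2r ?nnegrE// (le_trans _ (FC x)).
Qed.

Lemma bounded_mapD F H : bounded_map F -> bounded_map H ->
  bounded_map (fun x => F x + H x).
Proof.
move=> [C FC] [C' HC]; exists (C + C') => x.
by rewrite (le_trans (ler_normD _ _))// lerD.
Qed.

Lemma bounded_mapZ a F : bounded_map F -> bounded_map (fun x => a *: F x).
Proof.
by move=> [C FC]; exists (`|a| * C) => x; rewrite normrZ ler_wpM2l.
Qed.

Lemma mean_norm_ge0 F : 0 <= mean_norm F.
Proof. exact: sqrtr_ge0. Qed.

Lemma mean_normK F : bounded_map F ->
  mean_norm F ^+ 2 = m (fun x => `|F x| ^+ 2).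
Proof.
move=> Fb; rewrite sqr_sqrtr// mean_ge0//.
exact: sqr_norm_bounded.
Qed.

Lemma mean_norm_le F c : bounded_map F -> 0 <= c -> (forall x, `|F x| <= c) ->
  mean_norm F <= c.
Proof.
move=> Fb c0 Fc; rewrite -(@ler_pXn2r _ 2)// ?nnegrE ?mean_norm_ge0//.
rewrite mean_normK// -[leRHS]mean_cst; apply: mean_le.
- exact: sqr_norm_bounded.
- exact: bcst.
- by move=> x; rewrite lerXn2r ?nnegrE.
Qed.

Lemma mean_norm_ge F c : bounded_map F -> (forall x, c <= `|F x|) ->
  c <= mean_norm F.
Proof.
move=> Fb cF; have [c0|/ltW c0] := leP 0 c; last first.
  exact: le_trans c0 (mean_norm_ge0 F).
rewrite -(@ler_pXn2r _ 2)// ?nnegrE ?mean_norm_ge0//.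
rewrite mean_normK// -[leLHS]mean_cst; apply: mean_le.
- exact: bcst.
- exact: sqr_norm_bounded.
- by move=> x; rewrite lerXn2r ?nnegrE.
Qed.

Lemma mean_normZ a F : bounded_map F ->
  mean_norm (fun x => a *: F x) = `|a| * mean_norm F.
Proof.
move=> Fb; apply/eqP; rewrite -(@eqrXn2 _ 2)// ?mulr_ge0 ?mean_norm_ge0//.
rewrite exprMn !mean_normK//; last exact: bounded_mapZ.
have b2 := sqr_norm_bounded Fb.
have := mean_comb (`|a| ^+ 2) 0 b2 b2; rewrite mul0r addr0 => <-.
apply/eqP; congr (m _); apply/funext => x.
by rewrite normrZ exprMn mul0r addr0.
Qed.

(** Minkowski's inequality, obtained by averaging the pointwise inequality
(a + b)^2 <= (S + T) (a^2 / S + b^2 / T) for S and T slightly above the two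
norms, so that they are positive. *)
Lemma mean_normD F H : bounded_map F -> bounded_map H ->
  mean_norm (fun x => F x + H x) <= mean_norm F + mean_norm H.
Proof.
move=> Fb Hb; apply/ler_addgt0Pr => e e0.
have S0 := mean_norm_ge0 F; have T0 := mean_norm_ge0 H.
pose S := mean_norm F + e / 2; pose T := mean_norm H + e / 2.
have SS : mean_norm F < S by rewrite ltrDl divr_gt0.
have TT : mean_norm H < T by rewrite ltrDl divr_gt0.
have {S0}S0 : 0 < S by exact: le_lt_trans SS.
have {T0}T0 : 0 < T by exact: le_lt_trans TT.
have -> : mean_norm F + mean_norm H + e = S + T by rewrite /S /T; lra.
clearbody S T.
rewrite -(@ler_pXn2r _ 2)// ?nnegrE ?mean_norm_ge0 ?addr_ge0 ?(ltW S0)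
  ?(ltW T0)//.
rewrite mean_normK; last exact: bounded_mapD.
have b2 := sqr_norm_bounded Fb; have h2 := sqr_norm_bounded Hb.
apply: (@le_trans _ _ (m (fun x => ((S + T) / S) * `|F x| ^+ 2 +
    ((S + T) / T) * `|H x| ^+ 2))).
  apply: mean_le => [||x].
  - exact/sqr_norm_bounded/bounded_mapD.
  - exact: bcomb.
  - set a := `|F x|; set b := `|H x|.
    apply: (@le_trans _ _ ((a + b) ^+ 2)).
      by rewrite lerXn2r ?nnegrE ?addr_ge0 ?ler_normD//; exact: normr_ge0.
    rewrite -subr_ge0.
    have -> : (S + T) / S * a ^+ 2 + (S + T) / T * b ^+ 2 - (a + b) ^+ 2 =
      (T * a - S * b) ^+ 2 / (S * T) by field; rewrite !gt_eqF.
    by rewrite divr_ge0 ?sqr_ge0// mulr_ge0 ?(ltW S0) ?(ltW T0).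
rewrite mean_comb// -!mean_normK//.
apply: (@le_trans _ _ ((S + T) / S * S ^+ 2 + (S + T) / T * T ^+ 2)).
  have p1 : 0 <= (S + T) / S by rewrite divr_ge0 ?addr_ge0 ?(ltW S0) ?(ltW T0).
  have p2 : 0 <= (S + T) / T by rewrite divr_ge0 ?addr_ge0 ?(ltW S0) ?(ltW T0).
  by rewrite lerD// ler_wpM2l// lerXn2r ?nnegrE ?mean_norm_ge0 ?(ltW S0)
    ?(ltW T0) ?(ltW SS) ?(ltW TT).
rewrite le_eqVlt; apply/orP; left; apply/eqP; field; rewrite !gt_eqF//.
Qed.

(** The constants are those of [V]: they do not depend on the mean. *)
Lemma mean_norm_square_convex e K :
  square_convex_with (fun x : V => `|x|) setT e K -> 0 < K ->
  square_convex_with mean_norm bounded_map e K.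
Proof.
move=> VK K0 F H Fb Hb.
have FHb : bounded_map (2^-1 *: (F + H)) by exact/bounded_mapZ/bounded_mapD.
have FHb' : bounded_map (F - H).
  apply: bounded_mapD => //; have [C HC] := Hb.
  by exists C => x; rewrite normrN.
rewrite !mean_normK//.
have b2 := sqr_norm_bounded Fb; have h2 := sqr_norm_bounded Hb.
have s2 := sqr_norm_bounded FHb; have d2 := sqr_norm_bounded FHb'.
have : m (fun x => 1 * `|(F - H) x| ^+ 2 + K * `|(2^-1 *: (F + H)) x| ^+ 2) <=
    m (fun x => (e + K / 2) * `|F x| ^+ 2 + (e + K / 2) * `|H x| ^+ 2).
  apply: mean_le => [||x]; do ?exact: bcomb.
  have := VK (F x) (H x) I I; rewrite !fctE/=; lra.
rewrite !mean_comb//; lra.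
Qed.

End MeanNorm.
End Mean.

(** * Limits of partial affine actions *)

(** The maps [T x g] are isometric transports from the fibre over [act x g] to
the fibre over [x], which compose as they should as long as the group elements
are short compared with the scale [k]. *)
Section LimitAction.
Variables (R : realType) (G : groupType) (l : length_function R G).
Variables (B : normedModType R) (X : nat -> Type).
Variables (act : forall k, X k -> G -> X k) (m : forall k, mean R (X k)).
Variables (T : forall k, X k -> G -> B -> B) (r1 r2 : G -> R).
Hypothesis scB : square_convex B.
Hypothesis act1 : forall k (x : X k), act x 1%g = x.
Hypothesis actM : forall k (x : X k) g h, act x (g * h)%g = act (act x g) h.
Hypothesis m_inv : forall k g (f : X k -> R), bounded_fun f ->
  m k (fun x => f (act x g)) = m k f.
Hypothesis T_iso : forall k (x : X k) g u v, `|T x g u - T x g v| = `|u - v|.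
Hypothesis T1 : forall k (x : X k) u, T x 1%g u = u.
Hypothesis TM : forall k (x : X k) g h u, l g + l h <= k%:R ->
  T x (g * h)%g u = T x g (T (act x g) h u).
Hypothesis T_le : forall k (x : X k) g, l g <= k%:R -> `|T x g 0| <= r2 g.
Hypothesis T_ge : forall g, exists n, forall k, (n <= k)%N ->
  forall x : X k, r1 g <= `|T x g 0|.

(** A single space of functions, on the disjoint union of all the [X k], serves
for all scales. *)
Let E : lmodType R := ({k : nat & X k} -> B).

Let fib k (F : E) : X k -> B := fun x => F (existT X k x).

Let D : set E := [set F | forall k, bounded_map (@fib k F)].

Let N k (F : E) : R := mean_norm (m k) (@fib k F).

Let D0 : D 0.
Proof. by move=> k; exists 0 => x; rewrite normr0. Qed.

Let DL a F H : D F -> D H -> D (a *: F + H).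
Proof. by move=> FD HD k; apply: bounded_mapD (HD k); exact: bounded_mapZ. Qed.

Let DB F H : D F -> D H -> D (F - H).
Proof. by move=> DF DH; rewrite addrC -scaleN1r; exact: DL. Qed.

Let ND k F H : D F -> D H -> N k (F + H) <= N k F + N k H.
Proof. by move=> FD HD; exact: mean_normD. Qed.

Let NZ k a F : D F -> N k (a *: F) = `|a| * N k F.
Proof. by move=> FD; exact: mean_normZ. Qed.

Let N_eq0 k F H : D F -> D H -> (forall x, @fib k F x = @fib k H x) ->
  N k (F - H) = 0.
Proof.
move=> FD HD FH; apply/eqP; rewrite eq_le mean_norm_ge0 andbT.
apply: mean_norm_le => // [|x]; first exact: (DB FD HD k).
by have := FH x; rewrite /fib !fctE => ->; rewrite subrr normr0.
Qed.

Let glue (F : nat -> E) : (forall j, D (F j)) ->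
  exists2 H, D H & forall k, N k (H - F k) = 0.
Proof.
move=> FD; pose H : E := fun o => F (tag o) o.
have HD : D H by move=> k; have [C FC] := FD k k; exists C => x; exact: FC.
by exists H => // k; exact: N_eq0.
Qed.

(** At scales smaller than the length of [g], where [T x g] is not controlled,
[g] is made to act trivially; this does not change the limit. *)
Let A g (F : E) : E := fun o =>
  if l g <= (tag o)%:R then T (tagged o) g (F (existT X _ (act (tagged o) g)))
  else F o.

Let T_norm k (x : X k) g u : l g <= k%:R -> `|T x g u| <= `|u| + r2 g.
Proof.
move=> gk; rewrite -(subrK (T x g 0) (T x g u)).
rewrite (le_trans (ler_normD _ _))// T_iso subr0 lerD2l; exact: T_le.
Qed.

Let AD g F : D F -> D (A g F).
Proof.
move=> FD k; have [C FC] := FD k; exists (C + `|r2 g|) => x; rewrite /fib /A/=.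
case: ifP => [gk|_]; last by rewrite (le_trans (FC x))// lerDl.
by rewrite (le_trans (T_norm _ _ gk))// lerD ?ler_norm//; exact: FC.
Qed.

Let A_iso k g F H : D F -> D H -> N k (A g F - A g H) = N k (F - H).
Proof.
move=> FD HD; have [gk|gk] := boolP (l g <= k%:R); last first.
  congr (mean_norm (m k) _); apply/funext => x.
  by rewrite /fib !fctE/= /A/= (negbTE gk).
rewrite /N /mean_norm; congr Num.sqrt.
have FHD := DB FD HD; rewrite -(m_inv g (sqr_norm_bounded (FHD k))).
congr (m k _); apply/funext => x.
by rewrite /fib !fctE/= /A/= gk T_iso.
Qed.

Let A1 F : A 1%g F = F.
Proof.
apply/funext => -[k x]; rewrite /A/= (len_eq0 l 1%g).2// ler0n.
by rewrite act1 T1.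
Qed.

Let AM k g h F (x : X k) : l g + l h <= k%:R ->
  fib (A (g * h)%g F) x = fib (A g (A h F)) x.
Proof.
move=> ghk; have g0 := len_ge0 l g; have h0 := len_ge0 l h.
have gk : l g <= k%:R by lra.
have hk : l h <= k%:R by lra.
have gh : l (g * h)%g <= k%:R by exact: le_trans (lenM _ _ _) ghk.
by rewrite /fib /A/= gk hk gh TM// actM.
Qed.

Let bdd := uniformly_bounded D N.

Let bddB F H : bdd F -> bdd H -> bdd (F - H).
Proof.
move=> [FD [C FC]] [HD [C' HC]]; split; first exact: DB.
exists (C + C') => k; rewrite -scaleN1r.
have HD' : D (-1 *: H) by rewrite scaleN1r -sub0r; exact: DB.
by rewrite (le_trans (ND _ _ _))// NZ// normrN1 mul1r lerD.
Qed.

Let bdd0 : bdd 0.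
Proof.
by split=> //; exists 0 => k; rewrite -(scale0r 0) NZ// normr0 mul0r.
Qed.

Let A_bdd g F : bdd F -> bdd (A g F).
Proof.
move=> [FD [C FC]]; split; first exact: AD.
exists (C + `|r2 g|) => k; rewrite -(subrK (A g 0) (A g F)).
have AF := AD g FD; have A0 := AD g D0.
apply: (le_trans (ND _ (DB AF A0) A0)).
rewrite A_iso// subr0 lerD//; apply: mean_norm_le => // x.
rewrite /fib /A/=; case: ifP => [gk|_]; last by rewrite normr0.
by rewrite (le_trans (T_le _ gk))// ler_norm.
Qed.

(** The maps [A g] are isometric at every scale by invariance of the means, so
they induce isometries of the ultraproduct. The relation A (gh) = A g A h holds
at all scales at least l g + l h, hence exactly in the ultraproduct. The
isometries are bijective since they form a group action, and affine by
[mazur_ulam]. *)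
Lemma limit_action : exists B' : completeNormedModType R, square_convex B' /\
  exists alpha : G -> B' -> B',
    isometric_affine_action alpha /\ forall g, r1 g <= `|alpha g 0|.
Proof.
have [U [UU Uoo]] := ultrafilter_oo.
have [B' [c [cD cZ cS cN]]] := ultraproduct D0 DL ND NZ glue UU Uoo.
have cB x y : bdd x -> bdd y -> c (x - y) = c x - c y.
  move=> xb yb; have yb' : bdd (-1 *: y).
    by rewrite scaleN1r -sub0r; exact: bddB.
  by rewrite -scaleN1r cD// cZ// scaleN1r.
have cdist x y : bdd x -> bdd y -> N k (x - y) @[k --> U] --> `|c x - c y|.
  by move=> xb yb; rewrite -cB//; apply: cN; exact: bddB.
have c_eq x y : bdd x -> bdd y -> (\forall k \near U, N k (x - y) = 0) ->
    c x = c y.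
  move=> xb yb xy; apply/eqP; rewrite -subr_eq0 -normr_eq0; apply/eqP.
  apply: (@cvg_unique _ (@Rhausdorff R) (N k (x - y) @[k --> U])).
    exact: cdist.
  apply: (@cvg_trans _ (cst (0 : R) @ U)); last exact: cvg_cst.
  by apply: near_eq_cvg; apply: filterS xy => k ->.
have /choice[rep repP] : forall b, exists x, bdd x /\ c x = b.
  by move=> b; have [x xb <-] := cS b; exists x.
have rb b : bdd (rep b) := (repP b).1.
have cr b : c (rep b) = b := (repP b).2.
have sq (u : nat -> R) (a : R) :
    u k @[k --> U] --> a -> u k ^+ 2 @[k --> U] --> a ^+ 2.
  by move=> ua; apply: cvgM.
have scB' : square_convex B'.
  move=> e e0; have [K K0 KP] := scB e0; exists K => // x y _ _.
  have xb := rb x; have yb := rb y.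
  have sb : bdd (rep x + rep y).
    by rewrite -[rep y]opprK; apply: bddB => //; rewrite -sub0r; exact: bddB.
  have hb : bdd (2^-1 *: (rep x + rep y)).
    have [sD [C sC]] := sb; split; first by rewrite -[_ *: _]addr0; exact: DL.
    by exists (`|2^-1| * C) => k; rewrite NZ// ler_wpM2l.
  have -> : x - y = c (rep x - rep y) by rewrite cB// !cr.
  have -> : 2^-1 *: (x + y) = c (2^-1 *: (rep x + rep y)).
    by rewrite cZ// cD// !cr.
  rewrite -{2 3}(cr x) -{2 3}(cr y).
  have Nx := sq _ _ (cN _ xb); have Ny := sq _ _ (cN _ yb).
  have Nd := sq _ _ (cN _ (bddB xb yb)); have Ns := sq _ _ (cN _ hb).
  apply: (@ler_cvg_to _ U _ R _ (fun k =>
    e * (N k (rep x) ^+ 2 + N k (rep y) ^+ 2) +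
    K * ((N k (rep x) ^+ 2 + N k (rep y) ^+ 2) / 2 -
         N k (2^-1 *: (rep x + rep y)) ^+ 2)) _ _ Nd).
    apply: cvgD; apply: cvgMl_tmp; first exact: cvgD.
    apply: (@cvgB _ _ _ U _
      (fun k => (N k (rep x) ^+ 2 + N k (rep y) ^+ 2) / 2)).
      by apply: cvgMr_tmp; exact: cvgD.
    exact: Ns.
  apply: nearW => k.
  by apply: mean_norm_square_convex => //; [exact: xb.1|exact: yb.1].
pose alpha g b := c (A g (rep b)).
have alphaE g x : bdd x -> alpha g (c x) = c (A g x).
  move=> xb; apply/eqP; rewrite -subr_eq0 -normr_eq0; apply/eqP.
  apply: (@cvg_unique _ (@Rhausdorff R)
    (N k (A g (rep (c x)) - A g x) @[k --> U])).
    by apply: cdist; exact: A_bdd.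
  have := cdist _ _ (rb (c x)) xb; rewrite cr subrr normr0.
  apply: cvg_trans; apply: near_eq_cvg; apply: nearW => k.
  by rewrite A_iso//; [exact: (rb _).1|exact: xb.1].
have alpha_iso g b b' : `|alpha g b - alpha g b'| = `|b - b'|.
  apply: (@cvg_unique _ (@Rhausdorff R)
    (N k (A g (rep b) - A g (rep b')) @[k --> U])).
    by apply: cdist; exact: A_bdd.
  have := cdist _ _ (rb b) (rb b'); rewrite !cr.
  apply: cvg_trans; apply: near_eq_cvg; apply: nearW => k.
  by rewrite A_iso//; exact: (rb _).1.
have alpha1 b : alpha 1%g b = b by rewrite /alpha A1 cr.
have alphaM g h b : alpha (g * h)%g b = alpha g (alpha h b).
  rewrite [alpha h b]/alpha alphaE; last exact: A_bdd.
  apply: c_eq; do ?[exact: A_bdd | exact/A_bdd/A_bdd].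
  apply: filterS (Uoo (Num.truncn (l g + l h)).+1) => k /= kgh.
  apply: N_eq0; do ?[exact/AD/(rb _).1 | exact/AD/AD/(rb _).1].
  move=> x; apply: AM; apply: ltW; apply: lt_le_trans (truncnS_gt _) _.
  by rewrite ler_nat.
exists B'; split=> //; exists alpha; split.
- split=> [g|g h]; last by apply/funext => b; rewrite alphaM.
  apply: mazur_ulam => //; exists (alpha g^-1%g) => b.
    by rewrite -alphaM mulVg alpha1.
  by rewrite -alphaM mulgV alpha1.
- move=> g; have c0 : c 0 = 0 by rewrite -(scale0r (0 : E)) cZ// scale0r.
  rewrite -c0 alphaE//.
  apply: (ler_cvg_to (cvg_cst (r1 g)) (cN _ (A_bdd g bdd0))).
  have [n nP] := T_ge g.
  apply: filterS (Uoo (maxn n (Num.truncn (l g)).+1)) => k /=.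
  rewrite geq_max => /andP[/nP nk lk].
  have gk : l g <= k%:R.
    by apply: ltW; apply: lt_le_trans (truncnS_gt _) _; rewrite ler_nat.
  apply: mean_norm_ge => [|x]; first exact: (AD g D0 k).
  by rewrite /fib /A/= gk.
Qed.

End LimitAction.

(** * Quotients by a decreasing sequence of normal subgroups *)

Section Girth.
Local Open Scope quotient_scope.
Variables (R : realType) (G : groupType) (l : proper_length_function R G).
Variable N : nat -> normal_subgroup G.
Hypothesis N_decr : forall n, N n.+1 `<=` N n.
Hypothesis N_cap : \bigcap_n N n = [set 1%g].

(** The ball of radius [r] is finite, and each of its nontrivial elements
leaves the decreasing sequence [N] at some rank. *)
Lemma girth_diverges (r : R) : exists n0, forall n, (n0 <= n)%N ->
  forall g, nsg_set (N n) g -> l g <= r -> g = 1%g.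
Proof.
have Nle m n : (m <= n)%N -> N n `<=` N m.
  move=> /subnK <-; elim: (n - m)%N => // k ih.
  by apply: subset_trans ih; rewrite addSn; exact: N_decr.
have : finite_set [set g | l g <= Num.max r 0].
  by apply: (plen_proper l); rewrite le_max lexx orbT.
move=> /finite_seqP[s sE].
have /choice[f fP] : forall g, exists n, nsg_set (N n) g -> g = 1%g.
  move=> g; apply: contrapT => /forallNP gN.
  have : (\bigcap_n N n) g by move=> n _; apply: contrapT => nN; apply: (gN n).
  by rewrite N_cap => g1; apply: (gN 0).
exists (\max_(g <- s) f g)%N => n sn g gn gr.
have gs : g \in s.
  have : [set g | l g <= Num.max r 0] g by rewrite /= le_max gr.
  by rewrite sE.
apply: fP; apply: Nle gn; apply: leq_trans sn.
exact: leq_bigmax_seq.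
Qed.

(** A representative of the coset of [g] of minimal length differs from [g] by an
element of [N n] of length at most 2 l g. *)
Lemma coset_length_stable (g : G) : exists n0, forall n, (n0 <= n)%N ->
  coset_length l (\pi_(quotient_group (N n)) g) = l g.
Proof.
have [n0 n0P] := girth_diverges (l g + l g); exists n0 => n /n0P gN.
have [h hg hE] := coset_length_min l (\pi_(quotient_group (N n)) g).
have hl : l h <= l g by rewrite hE; exact: coset_length_le.
rewrite -hE; suff /mulg1_eq : (g^-1 * h)%g = 1%g by rewrite invgK => ->.
apply: gN; first by apply/clsP.
by rewrite (le_trans (lenM _ _ _))// lenV lerD2l.
Qed.

End Girth.

Section MeanOfAmenable.
Variables (R : realType) (Q : groupType).

(** The inversion turns left-invariance into right-invariance. *)
Lemma amenable_mean : amenable Q R -> exists m : mean R Q,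
  forall g (f : Q -> R), bounded_fun f -> m (fun x => f (x * g)%g) = m f.
Proof.
move=> [m [mL m0 m1 mI]].
have bV (f : Q -> R) : bounded_fun f -> bounded_fun (fun x => f x^-1%g).
  by move=> /bounded_fun_bound[C fC]; apply/bounded_fun_bound; exists C.
have mL' (a : R) (f g : Q -> R) : bounded_fun f -> bounded_fun g ->
    m (fun x => a * f x^-1%g + g x^-1%g) =
    a * m (fun x => f x^-1%g) + m (fun x => g x^-1%g).
  by move=> fb gb; apply: mL; exact: bV.
have m0' (f : Q -> R) : bounded_fun f -> (forall x, 0 <= f x) ->
    0 <= m (fun x => f x^-1%g).
  by move=> fb f0; apply: m0 => //; exact: bV.
exists (@Mean R Q (fun f => m (fun x => f x^-1%g)) mL' m0' m1) => g f fb /=.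
rewrite -(mI g _ (bV _ fb)); congr m; apply/funext => x.
by rewrite invgM invgK.
Qed.

End MeanOfAmenable.

(** * From an embedding of a box family to an action *)

(** The fibre over [x] is read through the trivialization over the ball [C x] of
radius [k], translated so that the section becomes the origin. *)
Section LocalCocycle.
Local Open Scope quotient_scope.
Variables (R : realType) (G : groupType) (l : proper_length_function R G).
Variables (N : normal_subgroup G) (B : completeNormedModType R).
Local Notation Q := (quotient_group N).
Local Notation X := (box_space l N).
Local Notation Y := (banach_metric B).
Variables (F : X -> metricType R) (s : forall x : X, F x) (rho1 rho2 : R -> R).
Variables (k : nat) (t : set X -> forall x : X, metric_isometry (F x) Y).

Definition translate (x : Q) (g : G) : Q := (x * \pi_Q g)%g.

(** Balls of radius [k] have diameter at most 2 k. *)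
Let r : R := k.*2.+1%:R.

Hypothesis t_rho : forall C : set X, (diameter C < r%:E)%E ->
  forall x x', C x -> C x' ->
    rho1 (mdist x x') <= mdist (t C x (s x)) (t C x' (s x'))
                      <= rho2 (mdist x x').
Hypothesis t_trans : forall C1 C2 : set X,
  (diameter C1 < r%:E)%E -> (diameter C2 < r%:E)%E -> C1 `&` C2 !=set0 ->
  exists2 t12 : Y -> Y, is_isometry t12 &
    forall x, (C1 `&` C2) x -> t C1 x \o iso_inv (t C2 x) = t12.

Let C (x : X) : set X := [set y | mdist x y <= k%:R].

Let C_diam x : (diameter (C x) < r%:E)%E.
Proof.
apply: (@le_lt_trans _ _ (k.*2%:R)%:E); last by rewrite lte_fin ltr_nat.
apply: ge_ereal_sup => _ [y yC [z zC <-]]; rewrite lee_fin.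
rewrite (le_trans (metric_triangle y x z))// [mdist y x]metric_sym.
by rewrite -addnn natrD lerD.
Qed.

Let mdist_translate (x : X) g :
  mdist x (translate x g : X) = coset_length l (\pi_Q g).
Proof. by rewrite box_mdistE /box_dist /length_dist /translate mulKg. Qed.

Let C_self x : C x x.
Proof. by rewrite /C/= mdistxx ler0n. Qed.

Let C_translate (x : X) g : l g <= k%:R -> C x (translate x g).
Proof.
move=> gk; rewrite /C/= mdist_translate; apply: le_trans gk.
exact: coset_length_le.
Qed.

Let sigma (x : X) : B := t (C x) x (s x).

(** Passage from the chart centred at [y] to the one centred at [x], above
[y]. *)
Let trans (x y : X) (v : B) : B := t (C x) y (iso_inv (t (C y) y) (v : Y)).

Let trans_iso x y u v : `|trans x y u - trans x y v| = `|u - v|.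
Proof.
rewrite /trans -!banach_mdistE iso_dist -(iso_dist (t (C y) y)).
by rewrite !iso_invK.
Qed.

Let trans_id x v : trans x x v = v.
Proof. exact: (iso_invK (t (C x) x) (v : Y)). Qed.

(** The change of charts from [C y] to [C x] is the same map above [y] and above
[z]; above [y] it is [trans x y], and composed with the passage from [C z] to
[C y] above [z] it is [trans x z]. *)
Let trans_comp x y z v : C x y -> C x z -> C y z ->
  trans x z v = trans x y (trans y z v).
Proof.
move=> xy xz yz.
have [|t12 _ tE] := t_trans (C_diam x) (C_diam y); first by exists y.
have ty w : t (C x) y (iso_inv (t (C y) y) w) = t12 w.
  by rewrite -(tE y).
have tz w : t (C x) z (iso_inv (t (C y) z) w) = t12 w.
  by rewrite -(tE z).
by rewrite /trans ty -tz iso_funK.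
Qed.

(** The vector [T x g 0] compares the section at [x] and at [translate x g] inside
the chart at [x], so its norm is controlled by their distance. *)
Lemma local_cocycle : exists T : Q -> G -> B -> B,
  [/\ forall x g u v, `|T x g u - T x g v| = `|u - v|,
      forall x u, T x 1%g u = u,
      forall x g h u, l g + l h <= k%:R ->
        T x (g * h)%g u = T x g (T (translate x g) h u)
    & forall x g, l g <= k%:R ->
        rho1 (coset_length l (\pi_Q g)) <= `|T x g 0|
                                        <= rho2 (coset_length l (\pi_Q g))].
Proof.
exists (fun x g v =>
  trans x (translate x g) (v + sigma (translate x g)) - sigma x).
split=> [x g u v|x u|x g h u ghk|x g gk].
- rewrite opprB addrA subrK trans_iso.
  by rewrite opprD addrACA subrr addr0.
- have -> : translate x 1%g = x by rewrite /translate pi_quotg1 mulg1.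
  by rewrite trans_id addrK.
- have g0 := len_ge0 l g; have h0 := len_ge0 l h.
  have ghM := lenM l g h.
  have xgh : translate x (g * h)%g = translate (translate x g) h.
    by rewrite /translate pi_quotgM mulgA.
  rewrite subrK xgh (@trans_comp _ (translate x g))//.
  + by apply: C_translate; lra.
  + by rewrite -xgh; apply: C_translate; lra.
  + by apply: C_translate; lra.
- rewrite add0r /trans /sigma iso_funK distrC -banach_mdistE.
  rewrite -[coset_length _ _](mdist_translate x).
  by apply: t_rho; [exact: C_diam|exact: C_self|exact: C_translate].
Qed.

End LocalCocycle.

Section EmbeddingToAction.
Local Open Scope quotient_scope.
Variables (R : realType) (G : groupType) (l : proper_length_function R G).

Lemma action_dist (B : completeNormedModType R) (alpha : G -> B -> B) g x y :
  isometric_affine_action alpha -> `|alpha g x - alpha g y| = `|x - y|.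
Proof.
move=> [aff _]; have [J [b [_ Jiso Jb]]] := aff g.
by rewrite !Jb opprD addrACA subrr addr0 -linearB Jiso.
Qed.

Lemma proper_of_control (B : completeNormedModType R) (alpha : G -> B -> B)
    (rho : R -> R) : isometric_affine_action alpha ->
  rho u @[u --> +oo] --> +oo -> (forall g, rho (l g) <= `|alpha g 0|) ->
  proper_action alpha.
Proof.
move=> aact rhoy rho_le x A Ab.
have [M AM] := @filter_ex _ (pinfty_nbhs R) _ _ Ab.
have [r [_ rP]] := (cvgryPgt rho).1 rhoy (M + `|x|).
apply: sub_finite_set (@plen_proper _ _ l (Num.max r 0) _); last first.
  by rewrite le_max lexx orbT.
move=> g /= Ag; rewrite le_max; apply/orP; left.
rewrite leNgt; apply/negP => rg.
have := lt_le_trans (rP _ rg) (rho_le g); apply/negP; rewrite -leNgt.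
rewrite -(subrK (alpha g x) (alpha g 0)) (le_trans (ler_normD _ _))//.
by rewrite action_dist// sub0r normrN addrC lerD2r; exact: AM.
Qed.

(** At scale [k] a quotient of rank at least [k] outside the exceptional finite
set is used, so that the coset lengths converge to [l]. *)
Lemma embedding_action (N : nat -> normal_subgroup G)
    (B : completeNormedModType R) :
  admissible R N -> uniformly_convex B ->
  fibred_cofinitely_coarse_embedding (box_family l N) (banach_metric B) ->
  exists B' : completeNormedModType R, uniformly_convex B' /\
    exists alpha : G -> B' -> B',
      isometric_affine_action alpha /\ proper_action alpha.
Proof.
move=> [Ndecr Ncap Nam] ucB [F [s [rho1 [rho2 [_ [_ rho1y] [rho2m _] emb]]]]].
have stab := coset_length_stable l Ndecr Ncap.
have /choice[n nP] : forall k : nat, exists i : nat, (k <= i)%N /\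
    exists T : quotient_group (N i) -> G -> B -> B,
    [/\ forall x g u v, `|T x g u - T x g v| = `|u - v|,
        forall x u, T x 1%g u = u,
        forall x g h u, l g + l h <= k%:R ->
          T x (g * h)%g u = T x g (T (translate x g) h u)
      & forall x g, l g <= k%:R ->
          rho1 (coset_length l (\pi_(quotient_group (N i)) g)) <= `|T x g 0|
          <= rho2 (coset_length l (\pi_(quotient_group (N i)) g))].
  move=> k; have [|K finK KP] := emb k.*2.+1%:R; first by rewrite ltr0n.
  have [i ki Ki] : exists2 i, (k <= i)%N & ~ K i.
    apply: contrapT => /forall2NP kK.
    apply: (@infinite_nat); apply: sub_finite_set (_ : finite_set (`I_k `|` K)).
      move=> i _; have [ik|ki] := ltnP i k; [by left|right].
      by have [|/contrapT] := kK i.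
    by rewrite finite_setU; split=> //; exact: finite_II.
  exists i; split=> //; have [t [t1 t2]] := KP i Ki.
  exact: local_cocycle t1 t2.
pose T k := projT1 (cid (nP k).2).
have T_iso k := let: And4 h _ _ _ := projT2 (cid (nP k).2) in h.
have T_1 k := let: And4 _ h _ _ := projT2 (cid (nP k).2) in h.
have T_M k := let: And4 _ _ h _ := projT2 (cid (nP k).2) in h.
have T_rho k := let: And4 _ _ _ h := projT2 (cid (nP k).2) in h.
pose m k := projT1 (cid (amenable_mean (Nam (n k)))).
have m_inv k := projT2 (cid (amenable_mean (Nam (n k)))).
have [||||||||B' [scB' [alpha [aact alpha_ge]]]] :=
  @limit_action R G l B (fun k => quotient_group (N (n k)))
    (fun k => @translate G (N (n k))) m T
    (fun g => rho1 (l g)) (fun g => rho2 (l g)) (uniformly_convex_square ucB).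
- by move=> k x; rewrite /translate pi_quotg1 mulg1.
- by move=> k x g h; rewrite /translate pi_quotgM mulgA.
- by move=> k g f; exact: m_inv.
- by move=> k x g u v; exact: T_iso.
- by move=> k x u; exact: T_1.
- by move=> k x g h u; exact: T_M.
- move=> k x g gk; have /andP[_ h] := T_rho k x g gk; apply: le_trans h _.
  apply: rho2m; last exact: coset_length_le.
  exact: (len_ge0 (coset_length_function l (N (n k)))).
- move=> g; have [i0 iP] := stab g.
  exists (maxn i0 (Num.truncn (l g)).+1) => k; rewrite geq_max => /andP[ik gk] x.
  have gk' : l g <= k%:R.
    by apply: ltW; apply: lt_le_trans (truncnS_gt _) _; rewrite ler_nat.
  have /andP[h _] := T_rho k x g gk'; apply: le_trans h.
  by rewrite iP// (leq_trans ik)//; exact: (nP k).1.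
exists B'; split; first exact: square_uniformly_convex.
exists alpha; split=> //.
exact: proper_of_control aact rho1y alpha_ge.
Qed.

End EmbeddingToAction.

(** * From an action to embeddings of box families *)

Lemma mdist_diameter (R : realType) (Z : metricType R)
    (C : set Z) (d : R) x y :
  (diameter C < d%:E)%E -> C x -> C y -> mdist x y < d.
Proof.
move=> Cd Cx Cy; rewrite -lte_fin; apply: le_lt_trans Cd.
by apply: ereal_sup_ubound; exists x => //; exists y.
Qed.

Section ShortLifts.
Local Open Scope quotient_scope.
Variables (R : realType) (G : groupType) (l : proper_length_function R G).
Variable N : normal_subgroup G.
Local Notation Q := (quotient_group N).
Local Notation X := (box_space l N).

Let shortest (q : Q) : G := s2val (cid2 (coset_length_min l q)).

Let shortestK q : \pi_Q (shortest q) = q.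
Proof. exact: (s2valP (cid2 (coset_length_min l q))). Qed.

Let shortest_len q : l (shortest q) = coset_length l q.
Proof. exact: (s2valP' (cid2 (coset_length_min l q))). Qed.

Let base (C : set X) : Q := xget (1%g : Q) C.

(** Lifts a small set [C] to [G], starting from a base point of [C]; points of
[C] are reached by shortest elements. *)
Definition lift (C : set X) (x : X) : G :=
  (repr (base C) * shortest ((base C)^-1 * x))%g.

Lemma pi_lift C x : \pi_Q (lift C x) = x.
Proof. by rewrite pi_quotgM reprK shortestK mulVKg. Qed.

(** Differences of two elements of length at most 2 r have to be separated from
the nontrivial elements of [N]. *)
Variable r : R.
Hypothesis girth : forall g, nsg_set N g -> l g <= 4 * r -> g = 1%g.

Lemma girth_inj g h : \pi_Q g = \pi_Q h -> l g <= 2 * r -> l h <= 2 * r -> g = h.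
Proof.
move=> /clsP gh gr hr; suff /mulg1_eq : (g^-1 * h)%g = 1%g by rewrite invgK.
by apply: girth => //; rewrite (le_trans (lenM _ _ _))// lenV; lra.
Qed.

Lemma lift_short C x y : (diameter C < r%:E)%E -> C x -> C y ->
  l ((lift C x)^-1 * lift C y)%g <= 2 * r.
Proof.
move=> Cr Cx Cy; rewrite /lift invgM -mulgA mulKg.
have Cb : C (base C : X) by apply: xgetPex; exists x.
have short z : C z -> l (shortest ((base C)^-1 * z)%g) < r.
  by move=> Cz; rewrite shortest_len; exact: (mdist_diameter Cr Cb Cz).
have := lenM l (shortest ((base C)^-1 * x))^-1%g (shortest ((base C)^-1 * y)%g).
by rewrite lenV; have := short x Cx; have := short y Cy; lra.
Qed.

Lemma pi_lift_diff C x y : \pi_Q ((lift C x)^-1 * lift C y)%g = (x^-1 * y)%g.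
Proof. by rewrite pi_quotgM pi_quotgV !pi_lift. Qed.

(** The lift is isometric: the difference of two lifts and the shortest
representative of its coset both have length at most 2 r. *)
Lemma lift_len C x y : (diameter C < r%:E)%E -> C x -> C y ->
  l ((lift C x)^-1 * lift C y)%g = mdist x y.
Proof.
move=> Cr Cx Cy; have u2 := lift_short Cr Cx Cy; set u := (_ * _)%g in u2 *.
have uq : \pi_Q u = (x^-1 * y)%g by exact: pi_lift_diff.
have [v vq vl] := coset_length_min l (x^-1 * y : Q)%g.
have vu : l v <= l u by rewrite vl -uq; exact: coset_length_le.
rewrite (@girth_inj u v) ?uq//; last exact: le_trans u2.
Qed.

(** Two lifts of the same points differ by a left translation of [G], because
differences of length at most 2 r are determined by their cosets. *)
Lemma lift_diff C1 C2 x y : (diameter C1 < r%:E)%E -> (diameter C2 < r%:E)%E ->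
  (C1 `&` C2) x -> (C1 `&` C2) y ->
  ((lift C1 x)^-1 * lift C1 y = (lift C2 x)^-1 * lift C2 y)%g.
Proof.
move=> C1r C2r [C1x C2x] [C1y C2y]; apply: girth_inj.
- by rewrite !pi_lift_diff.
- exact: lift_short.
- exact: lift_short.
Qed.

End ShortLifts.

Lemma finite_set_bounded (R : realType) (T : choiceType) (A : set T) (f : T -> R) :
  finite_set A -> exists r, forall x, A x -> f x <= r.
Proof.
move=> /finite_seqP[s ->]; exists (\big[Order.max/0]_(x <- s) f x) => x xs.
exact: le_bigmax_seq.
Qed.

Section ActionToEmbedding.
Local Open Scope quotient_scope.
Variables (R : realType) (G : groupType) (l : proper_length_function R G).
Variables (B : completeNormedModType R) (alpha : G -> B -> B).
Hypothesis aact : isometric_affine_action alpha.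
Hypothesis aproper : proper_action alpha.
Local Notation Y := (banach_metric B).

Let alpha1 x : alpha 1%g x = x.
Proof.
apply/eqP; rewrite -subr_eq0 -normr_eq0 -(action_dist 1%g _ _ aact).
have -> : alpha 1%g (alpha 1%g x) = alpha 1%g x.
  by rewrite -[LHS]/((alpha 1%g \o alpha 1%g) x) -aact.2 mulg1.
by rewrite subrr normr0.
Qed.

Let alphaM g h x : alpha (g * h)%g x = alpha g (alpha h x).
Proof. by rewrite aact.2. Qed.

Let displacement g : R := `|alpha g 0|.

Let alpha_orbit g h : `|alpha g 0 - alpha h 0| = displacement (g^-1 * h)%g.
Proof.
by rewrite -{1}(mulVKg g h) alphaM action_dist// sub0r normrN.
Qed.

(** The sets whose infimum and supremum are the control functions. The
half-lines keep the sets nonempty and the functions unbounded even if [G] is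
finite. *)
Let low u : set R :=
  [set displacement g | g in [set g | u <= l g]] `|` [set v | u <= v].

Let high u : set R :=
  [set displacement g | g in [set g | l g <= u]] `|` [set v | v <= u].

Let low_inf u : has_inf (low u).
Proof.
split; first by exists u; right; exact: lexx.
exists (Num.min 0 u) => v [[g _ <-]|/= uv]; rewrite ge_min ?normr_ge0//.
by rewrite uv orbT.
Qed.

Let high_sup u : 0 <= u -> has_sup (high u).
Proof.
move=> u0; split; first by exists u; right; exact: lexx.
have [r rP] := finite_set_bounded displacement (plen_proper l u0).
exists (Num.max r u) => v [[g gu <-]|/= vu]; rewrite le_max ?rP//.
by rewrite vu orbT.
Qed.

Let low_control : control_function (fun u => inf (low u)).
Proof.
split=> [u v _ uv|].
  apply: lb_le_inf; first exact: (low_inf v).1.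
  move=> x [[g gv <-]|vx]; apply: ge_inf; do ?exact: (low_inf u).2.
  - by left; exists g => //; exact: le_trans gv.
  - by right; exact: le_trans vx.
apply/cvgryPge => A.
have [r rP] : exists r, forall g, displacement g <= A -> l g <= r.
  apply: finite_set_bounded.
  apply: (aproper 0 (_ : bounded_set [set x | `|x| <= A])).
  exists A; split=> [|M AM x /= xA]; first exact: num_real.
  exact: le_trans (ltW AM).
near=> u; apply: lb_le_inf; first exact: (low_inf u).1.
have ru : r < u by near: u; apply: nbhs_pinfty_gt; exact: num_real.
have Au : A <= u by near: u; apply: nbhs_pinfty_ge; exact: num_real.
move=> v [[g gu <-]|/= uv]; last exact: le_trans uv.
rewrite leNgt; apply/negP => /ltW/rP gr.
by have := le_lt_trans (le_trans gu gr) ru; rewrite ltxx.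
Unshelve. all: by end_near. Qed.

Let high_control : control_function (fun u => sup (high u)).
Proof.
split=> [u v u0 uv|].
  have v0 := le_trans u0 uv.
  apply: ge_sup; first exact: (high_sup u0).1.
  move=> x [[g gu <-]|xu]; apply: ub_le_sup; do ?exact: (high_sup v0).2.
  - by left; exists g => //; exact: le_trans uv.
  - by right; exact: le_trans uv.
apply/cvgryPge => A; near=> u.
have u0 : 0 <= u by near: u; apply: nbhs_pinfty_ge; exact: num_real.
have Au : A <= u by near: u; apply: nbhs_pinfty_ge; exact: num_real.
apply: le_trans Au _; apply: ub_le_sup; first exact: (high_sup u0).2.
by right; exact: lexx.
Unshelve. all: by end_near. Qed.

Let displacement_control g :
  inf (low (l g)) <= displacement g <= sup (high (l g)).
Proof.
apply/andP; split.
- by apply: ge_inf; [exact: (low_inf _).2|left; exists g => //; exact: lexx].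
- apply: ub_le_sup; first exact: (high_sup (len_ge0 _ _)).2.
  by left; exists g => //; exact: lexx.
Qed.

Let alphaK h : cancel (alpha h : Y -> Y) (alpha h^-1%g : Y -> Y).
Proof. by move=> x; rewrite -alphaM mulVg alpha1. Qed.

Let alphaVK h : cancel (alpha h^-1%g : Y -> Y) (alpha h : Y -> Y).
Proof. by move=> x; rewrite -alphaM mulgV alpha1. Qed.

Let alpha_mdist h (x y : Y) : mdist (alpha h x : Y) (alpha h y : Y) = mdist x y.
Proof. by rewrite !banach_mdistE action_dist. Qed.

Let alpha_isometry h : metric_isometry Y Y :=
  MetricIsometry (alphaK h) (alphaVK h) (@alpha_mdist h).

(** All fibres are copies of [B], with section [alpha (repr x) 0]. Over a small
set [C] the trivialization moves it to [alpha (lift C x) 0], so that distances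
become displacements of elements whose lengths are the distances in [C]. By
[lift_diff] the change of trivialization is the action of a single element. *)
Lemma action_embedding (N : nat -> normal_subgroup G) :
  (forall n, N n.+1 `<=` N n) -> \bigcap_n N n = [set 1%g] ->
  fibred_cofinitely_coarse_embedding (box_family l N) Y.
Proof.
move=> Ndecr Ncap.
exists (fun _ _ => Y), (fun n (x : quotient_group (N n)) => alpha (repr x) 0).
exists (fun u => inf (low u)), (fun u => sup (high u)).
split=> // [i x|r r0].
  by exists; exact: (alpha_isometry 1%g).
have [n0 n0P] := girth_diverges l Ndecr Ncap (4 * r).
exists `I_n0; first exact: finite_II.
move=> i /negP; rewrite -leqNgt => /n0P girth.
exists (fun C x => alpha_isometry (lift C x * (repr x)^-1)%g); split.
  move=> C Cr x y Cx Cy /=.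
  rewrite -!alphaM !mulgVK banach_mdistE alpha_orbit -(lift_len girth Cr Cx Cy).
  exact: displacement_control.
move=> C1 C2 C1r C2r [x Cx].
exists (alpha_isometry (lift C1 x * (lift C2 x)^-1)%g); first exact: alpha_mdist.
move=> y Cy; apply/funext => v /=; rewrite -alphaM; congr (alpha _ v).
rewrite invgM invgK mulgA mulgVK.
have e := lift_diff girth C1r C2r Cx Cy.
rewrite -(mulVKg (lift C1 x) (lift C1 y)) e.
by rewrite mulgA mulgK.
Qed.

End ActionToEmbedding.

(** * The equivalence *)

Theorem theorem1p1 (R : realType) (G : groupType)
  (l : proper_length_function R G)
  (hG : residually_amenable R G) :
  [<->
    exists B : completeNormedModType R, uniformly_convex B /\
      exists alpha : G -> B -> B,
        isometric_affine_action alpha /\ proper_action alpha;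

    exists N : nat -> normal_subgroup G, admissible R N /\
      exists B : completeNormedModType R, uniformly_convex B /\
        fibred_cofinitely_coarse_embedding (box_family l N) (banach_metric B);

    forall N : nat -> normal_subgroup G, admissible R N ->
      exists B : completeNormedModType R, uniformly_convex B /\
        fibred_cofinitely_coarse_embedding (box_family l N) (banach_metric B)
  ].
Proof.
have [_ _ [N0 N0adm]] := hG.
tfae.
- move=> [B [ucB [alpha [aact aproper]]]]; exists N0; split=> //.
  exists B; split=> //; have [Ndecr Ncap _] := N0adm.
  exact: action_embedding aproper _ Ndecr Ncap.
- move=> [N1 [N1adm [B1 [ucB1 emb]]]] N [Ndecr Ncap _].
  have [B [ucB [alpha [aact aproper]]]] := embedding_action N1adm ucB1 emb.
  by exists B; split=> //; exact: action_embedding aproper _ Ndecr Ncap.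
- move=> /(_ N0 N0adm) [B [ucB emb]]; exact: embedding_action N0adm ucB emb.
Qed.
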